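(* Consider the abstract problem $u'(t)=Au(t)+f(t)$, $0\le t\le T$, $u(0)=u_0$, $\partial u(t)=g(t)$ with $g\equiv 0$, together with the space semidiscretization $U_h'(t)=A_{h,0}U_h(t)+L_hf(t)$, $U_h(0)=L_hu(0)$, and its time integration by the exponential quadrature rule with $s$ nodes $$U_h^{n+1}=e^{kA_{h,0}}U_h^n+k\sum_{i,j=1}^s a_{i,j}\varphi_j(kA_{h,0})L_hf(t_n+c_ik),\qquad t_n=nk.$$ Let $\bar U_h^{n+1}$ be the result of one step of this scheme started from $U_h(t_n)$ instead of $U_h^n$, and set $\rho_{h,n+1}=U_h(t_{n+1})-\bar U_h^{n+1}$, $e_{h,n}=U_h(t_n)-U_h^n$. If $u\in C([0,T],Z)$ and $f\in C^s([0,T],X)$, then (i) $\rho_{h,n}=O(k^{s+1})$; (ii) $e_{h,n}=O(k^s)$; (iii) $L_hu(t_n)-U_h^n=O(k^s+\varepsilon_h)$, where the constants in the Landau notation are independent of $k$ and $h$ (norms being $\|\cdot\|_h$).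
   Context: $X$, $Y$ are complex Banach spaces, $A:D(A)\subset X\to X$ linear with $D(A)$ dense, $\partial:D(A)\to Y$ linear. Standing assumptions: (A1) $\partial$ is onto; (A2) $\mathrm{Ker}(\partial)$ is dense in $X$ and $A_0$, the restriction of $A$ to $D(A_0)=\mathrm{Ker}(\partial)$, generates a $C_0$-semigroup $e^{tA_0}$ of negative type $\omega$; (A3) for $\mathrm{Re}\,z>\omega$ and $v\in Y$ the problem $Ax=zx$, $\partial x=v$ has a unique solution $x=K(z)v$ with $\|K(z)v\|_X\le L\|v\|_Y$ uniformly for $\mathrm{Re}\,z>\omega_0>\omega$. The functions $\varphi_j$ are $\varphi_0(z)=e^z$, $\varphi_j(tB)=t^{-j}\int_0^te^{(t-\tau)B}\tau^{j-1}/(j-1)!\,d\tau$ ($j\ge1$). Given distinct nodes $c_1,\dots,c_s$, the coefficients $a_{i,j}$ are defined by writing the Lagrange basis polynomials as $l_i(\theta)=\sum_{j=1}^s a_{i,j}\theta^{j-1}/(j-1)!$. Space discretization: for $h$ in a sequence tending to $0$, $X_h\subset X$ is finite-dimensional with norm $\|\cdot\|_h$, $X_{h,0}\subset X_h$ a subspace; $A_{h,0}$ approximates $A_0$ on $X_{h,0}$, $A_h$ approximates $A$; $L_h:X\to X_{h,0}$ is a projection, $Q_h:Y\to X_h$, and for the elliptic problem $Aw=F$, $\partial w=g$ the elliptic projection $R_hw\in X_{h,0}$ satisfies $A_{h,0}R_hw+A_hQ_hg=L_hF$; $P_h=L_h-L_hQ_h\partial$. $Z\subset X$ is a subspace with norm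 $\|\cdot\|_Z$ and $\|A_{h,0}(R_h-P_h)u\|_h\le\varepsilon_h\|u\|_Z$ for $u\in Z$, with $\varepsilon_h$ decreasing with $h$. The operators $e^{tA_{h,0}}$ ($t\ge0$), $L_h$, $L_hQ_h$, $P_h$ are bounded uniformly in $h$ (part of the paper's standing spatial-discretization hypotheses). *)

(* Defs.v *)
From HB Require Import structures.
From mathcomp Require Import all_boot all_order all_algebra.
From mathcomp Require Import all_classical all_reals all_analysis.
From mathcomp Require Import complex.
Import Order.TTheory GRing.Theory Num.Theory.
Import numFieldNormedType.Exports.

Set Implicit Arguments.
Unset Strict Implicit.
Unset Printing Implicit Defensive.

Local Open Scope ring_scope.
Local Open Scope classical_set_scope.

Section Defs.
Variable R : realType.

Definition cR (r : R) : R[i] := Complex r 0.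

Section Banach.
Variable X : normedModType R[i].

(* real-valued norm of X (the library norm is R[i]-valued with zero imaginary part) *)
Definition nrm (x : X) : R := complex.Re `|x|.

Definition lin_subspace (S : set X) : Prop :=
  S 0 /\ forall (a : R[i]) x y, S x -> S y -> S (a *: x + y).

Definition linear_on (Y : lmodType R[i]) (S : set X) (F : X -> Y) : Prop :=
  forall (a : R[i]) x y, S x -> S y -> F (a *: x + y) = a *: F x + F y.

Definition fin_dim (S : set X) : Prop :=
  lin_subspace S /\ exists b : seq X, forall x, S x <->
    exists alpha : 'I_(size b) -> R[i], x = \sum_(i < size b) alpha i *: b`_i.

Definition norm_on (S : set X) (nh : X -> R) : Prop :=
  (forall x, S x -> 0 <= nh x) /\
  (forall x, S x -> nh x = 0 -> x = 0) /\
  (forall x y, S x -> S y -> nh (x + y) <= nh x + nh y) /\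
  (forall (a : R[i]) x, S x -> nh (a *: x) = complex.Re `|a| * nh x).

Definition C0_semigroup_generated_by (S : R -> X -> X) (M omega : R)
    (D0 : set X) (A0 : X -> X) : Prop :=
  (forall t, 0 <= t -> linear_on setT (S t)) /\
  (forall x, S 0 x = x) /\
  (forall t r x, 0 <= t -> 0 <= r -> S (t + r) x = S t (S r x)) /\
  (forall x, (fun t => S t x) @ 0^'+ --> x) /\
  (forall t x, 0 <= t -> nrm (S t x) <= M * expR (omega * t) * nrm x) /\
  (forall x, D0 x <-> cvg ((fun t => cR t^-1 *: (S t x - x)) @ 0^'+)) /\
  (forall x, D0 x -> (fun t => cR t^-1 *: (S t x - x)) @ 0^'+ --> A0 x).

Definition opexp (B : X -> X) (t : R) (x : X) : X :=
  lim ((fun N => \sum_(m < N) cR (t ^+ m / (m`!)%:R) *: iter m B x) @ \oo).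

(* Riemann integral over [0,t] of a continuous X-valued function
   (limit of the uniform Riemann sums) *)
Definition rint (t : R) (g : R -> X) : X :=
  lim ((fun N => cR (t / (N.+1)%:R) *:
         \sum_(i < N.+1) g (t * (i%:R) / (N.+1)%:R)) @ \oo).

Definition phi (j : nat) (B : X -> X) (t : R) (x : X) : X :=
  match j with
  | 0 => opexp B t x
  | j'.+1 => cR (t ^- j) *:
      rint t (fun tau => cR (tau ^+ j' / (j'`!)%:R) *: opexp B (t - tau) x)
  end.

Definition deriv_on (T : R) (g g' : R -> X) : Prop :=
  forall t, 0 <= t <= T ->
    (fun r => cR r^-1 *: (g (t + r) - g t))
      @ within (fun r => r != 0 /\ 0 <= t + r <= T) (nbhs (0 : R)) --> g' t.

Definition Cs_on (T : R) (s : nat) (g : R -> X) : Prop :=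
  exists G : nat -> R -> X, G 0%N = g /\
    (forall i, (i <= s)%N -> {within `[0, T], continuous (G i)}) /\
    (forall i, (i < s)%N -> deriv_on T (G i) (G i.+1)).

Definition C_on_Z (T : R) (Z : set X) (nZ : X -> R) (g : R -> X) : Prop :=
  (forall t, 0 <= t <= T -> Z (g t)) /\
  (forall t, 0 <= t <= T -> forall e, 0 < e -> exists2 d, 0 < d &
     forall t', 0 <= t' <= T -> `|t' - t| < d -> nZ (g t' - g t) < e).

End Banach.

Definition lagr (s : nat) (c : 'I_s -> R) (i : 'I_s) : {poly R} :=
  \prod_(m < s | m != i) (('X - (c m)%:P) * ((c i - c m)^-1)%:P).

(* a_{i,j+1}, so that l_i(theta) = sum_{j<s} a_{i,j+1} theta^j / j! *)
Definition acoef (s : nat) (c : 'I_s -> R) (i j : 'I_s) : R :=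
  (lagr c i)`_j * (j`!)%:R.

Section Scheme.
Variables (X : normedModType R[i]) (s : nat) (c : 'I_s -> R).

Definition eq_step (B Lh : X -> X) (f : R -> X) (k t : R) (V : X) : X :=
  opexp B k V + cR k *: \sum_(i < s) \sum_(j < s)
     cR (acoef c i j) *: phi j.+1 B k (Lh (f (t + c i * k))).

Fixpoint eq_scheme (B Lh : X -> X) (f : R -> X) (k : R) (U0 : X) (n : nat) : X :=
  match n with
  | 0 => U0
  | n'.+1 => eq_step B Lh f k (n'%:R * k) (eq_scheme B Lh f k U0 n')
  end.

End Scheme.

Definition Ph (X Y : normedModType R[i]) (Lh : X -> X) (Qh : Y -> X) (dA : X -> Y)
  (x : X) : X := Lh x - Lh (Qh (dA x)).

End Defs.

(* Main.v *)
Require Import Defs.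
From HB Require Import structures.
From mathcomp Require Import all_boot all_order all_algebra.
From mathcomp Require Import all_classical all_reals all_analysis.
From mathcomp Require Import complex.
From mathcomp Require Import ring lra.
Import Order.TTheory GRing.Theory Num.Theory.
Import numFieldNormedType.Exports.
Set Implicit Arguments.
Unset Strict Implicit.
Unset Printing Implicit Defensive.
Local Open Scope ring_scope.
Local Open Scope classical_set_scope.

(* Let B := A_{h,0} L_h. It is a bounded operator on all of X, [x |-> |L_h x|_h] is a
   seminorm on X bounded by |x|_X, and on X_{h,0} they reduce to A_{h,0} and |.|_h; thus the
   finite-dimensional problem is handled with operators on X whose relevant constants do
   not depend on h. Duhamel's principle takes the form of a mean value inequality for
   [tau |-> e^{(k - tau)B} v(tau)], whose derivative is e^{(k - tau)B}(v' - B v): the distance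
   of v(k) to e^{kB} v(0) is at most k sup |e^{(k - tau)B}(v' - B v)|.
   (i) tau^{j+1} phi_{j+1}(tau B) y =: E(tau) solves E' = B E + (tau^j / j!) y. So U_h minus
   the quadrature correction solves, on one step, an equation with source term
   L_h (f - its Lagrange interpolant) = O(k^s).
   (ii) follows by summing the local errors, propagated by the semigroup.
   (iii) L_h u - U_h has source term A_{h,0}(R_h - P_h)u = O(eps_h) and vanishes at 0. *)

(** The obstacle is uniformity in h. The norms [nh m] are controlled by the norm of X only through
    L_h, and A_{h,0} is bounded on X_{h,0} merely because the dimension is finite, with a constant
    that may grow as h tends to 0. That constant may serve convergence and differentiability, which
    are qualitative; the error bounds must contain only the uniform bounds of e^{tA_{h,0}} and L_h.
    Hence the mean value inequality is stated for a seminorm, and its conclusion keeps no trace of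
    how that seminorm compares with the norm of X. Arguing with derivatives avoids a theory of
    vector-valued integrals: the integral defining phi_{j+1} is evaluated once, as a limit of
    Riemann sums, and replaced by a power series. Orders: interpolation leaves a source O(k^s), a
    step of length k gains one factor k, and summing n local errors loses it again because nk <= T.
    No power of the stability constant builds up in that sum, since the propagators between a local
    error and the final time merge into a single exponential. *)

Local Notation "a *r x" := (cR a *: x) (at level 40).

(** * Real scalars and the real-valued norm of a complex space *)

Section RealScalars.
Variable R : realType.
Implicit Types a b : R.

Lemma cRD a b : cR (a + b) = cR a + cR b.
Proof. by rewrite /cR; apply/eqP; rewrite eq_complex /= addr0 !eqxx. Qed.

Lemma cRN a : cR (- a) = - cR a.
Proof. by rewrite /cR; apply/eqP; rewrite eq_complex /= oppr0 !eqxx. Qed.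

Lemma cRB a b : cR (a - b) = cR a - cR b.
Proof. by rewrite cRD cRN. Qed.

Lemma cRM a b : cR (a * b) = cR a * cR b.
Proof.
by rewrite /cR; apply/eqP; rewrite eq_complex /= !(mulr0, mul0r, addr0, subr0) !eqxx.
Qed.

Lemma cR0 : cR 0 = 0 :> R[i]. Proof. by []. Qed.

Lemma cR1 : cR 1 = 1 :> R[i]. Proof. by []. Qed.

Lemma cR_lt a b : (cR a < cR b) = (a < b).
Proof. exact: ltcR. Qed.

Lemma cR_le a b : (cR a <= cR b) = (a <= b).
Proof. exact: lecR. Qed.

Lemma Re_norm_cR a : complex.Re `|cR a| = `|a|.
Proof. by rewrite normc_def /= expr0n /= addr0 sqrtr_sqr. Qed.

Lemma cR_gt0P (e : R[i]) : 0 < e -> exists2 r, 0 < r & e = cR r.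
Proof.
case: e => r i; rewrite ltcE /= => /andP[/eqP -> r0].
by exists r.
Qed.

End RealScalars.

Section RealNorm.
Variables (R : realType) (X : normedModType R[i]).
Implicit Types (x y : X) (a b e : R).

Lemma cR_nrm x : cR (nrm x) = `|x|.
Proof.
have := normr_ge0 x; rewrite /nrm; case: (`|x|) => r i.
by rewrite lecE /= => /andP[/eqP -> _].
Qed.

Lemma nrm_ge0 x : 0 <= nrm x.
Proof. by rewrite -cR_le cR_nrm cR0. Qed.

Lemma nrmD x y : nrm (x + y) <= nrm x + nrm y.
Proof. by rewrite -cR_le cRD !cR_nrm ler_normD. Qed.

Lemma nrmZ (z : R[i]) x : nrm (z *: x) = complex.Re `|z| * nrm x.
Proof. by rewrite /nrm normrZ; rewrite -cR_nrm -/(nrm x) normc_def /= mul0r subr0. Qed.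

Lemma nrmZr a x : nrm (a *r x) = `|a| * nrm x.
Proof. by rewrite nrmZ Re_norm_cR. Qed.

Lemma nrmN x : nrm (- x) = nrm x.
Proof. by rewrite /nrm normrN. Qed.

Lemma nrmB x y : nrm (x - y) <= nrm x + nrm y.
Proof. by rewrite -(nrmN y) nrmD. Qed.

Lemma nrm_distC x y : nrm (x - y) = nrm (y - x).
Proof. by rewrite -nrmN opprB. Qed.

Lemma nrm0 : nrm (0 : X) = 0.
Proof. by rewrite /nrm normr0. Qed.

Lemma nrm_eq0 x : nrm x = 0 -> x = 0.
Proof. by move=> x0; apply/normr0_eq0; rewrite -cR_nrm x0. Qed.

Lemma nrm_sum I (r : seq I) (F : I -> X) :
  nrm (\sum_(i <- r) F i) <= \sum_(i <- r) nrm (F i).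
Proof.
elim/big_ind2: _ => [|x a y b xa yb|//]; first by rewrite nrm0.
exact: le_trans (nrmD _ _) (lerD xa yb).
Qed.

Lemma cvg_nrmP (x_ : nat -> X) x : x_ @ \oo --> x <->
  forall e, 0 < e -> exists N, forall n, (N <= n)%N -> nrm (x_ n - x) <= e.
Proof.
split=> [/cvgrPdistC_le xx e e0|xx].
  have /xx[N _ xN] : 0 < cR e by rewrite -cR0 cR_lt.
  by exists N => n /xN /=; rewrite -cR_nrm cR_le.
apply/cvgrPdistC_le => _ /cR_gt0P[e /xx[N xN] ->].
by exists N => // n /xN /=; rewrite -cR_nrm cR_le.
Qed.

Lemma nrm_lim_le (x_ : nat -> X) x b :
  x_ @ \oo --> x -> (forall n, nrm (x_ n) <= b) -> nrm x <= b.
Proof.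
move=> /cvg_nrmP xx xb; apply/ler_addgt0Pr => e /xx[N] /(_ N (leqnn _)) xN.
have := nrmB (x_ N) (x_ N - x); rewrite subKr => /le_trans; apply.
by apply: lerD.
Qed.

End RealNorm.

Lemma cvg_cauchy_nrm (R : realType) (X : completeNormedModType R[i]) (x_ : nat -> X) :
  (forall e : R, 0 < e -> exists N, forall n m, (N <= n)%N -> (n <= m)%N ->
    nrm (x_ m - x_ n) <= e) -> cvg (x_ @ \oo).
Proof.
move=> xC; apply/cauchy_cvgP/cauchy_exP => _ /cR_gt0P[e e0 ->].
have [N xN] := xC (e / 2) (divr_gt0 e0 (ltr0n _ 2)).
exists (x_ N); exists N => // n /= Nn.
rewrite -ball_normE /ball_ /= distrC -cR_nrm cR_lt.
by apply: le_lt_trans (xN _ _ (leqnn _) Nn) _; lra.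
Qed.

(** Compactness of [0, L] in supremum form: a short interval around the supremum of the good
    endpoints pushes past it. The local property concerns only intervals containing t, which is what
    boundedness or differentiability at the single point t can supply. *)
Lemma segment_propagation (R : realType) (L : R) (P : R -> R -> Prop) : 0 <= L ->
  (forall a b c, a <= b -> b <= c -> P a b -> P b c -> P a c) ->
  (forall t, 0 <= t <= L -> exists2 d, 0 < d & forall a b,
     0 <= a -> a <= t -> t <= b -> b <= L -> b - a < d -> P a b) ->
  P 0 L.
Proof.
move=> L0 Pcat Ploc.
pose S := [set x : R | 0 <= x <= L /\ P 0 x].
have S0 : S 0.
  split; first by rewrite lexx L0.
  have [|d d0] := Ploc 0; first by rewrite lexx L0.
  by apply => //; rewrite subrr.
have supS : has_sup S by split; [exists 0 | exists L => x [/andP[]]].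
have s0 : 0 <= sup S by apply: ub_le_sup => //; case: supS.
have sL : sup S <= L by apply: ge_sup; [exists 0|move=> x [/andP[]]].
have [|d d0 Pd] := Ploc (sup S); first by rewrite s0.
have d20 : 0 < d / 2 by apply: divr_gt0.
have [x [/andP[x0 xL] Px] xs] := sup_adherent d20 supS.
have xsup : x <= sup S.
  by apply: ub_le_sup; [case: supS|split; rewrite ?x0].
(* [x] lies less than d/2 to the left of the supremum and [y] at most d/4 to its right, so the
   interval from [x] to [y] is shorter than d and contains the supremum. *)
pose y := Num.min L (sup S + d / 4).
have sy : sup S <= y by rewrite le_min sL; lra.
have yL : y <= L by rewrite ge_min lexx.
have yd : y <= sup S + d / 4 by rewrite ge_min lexx orbT.
have Py : P 0 y by apply: (Pcat _ x) => //; [lra|apply: Pd => //; lra].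
have : y <= sup S.
  by apply: ub_le_sup; [case: supS|split=> //; apply/andP; split=> //; lra].
move=> ys; have yE : y = L.
  by move: (ys); rewrite {1}/y ge_min => /orP[Ls|]; [apply/le_anti; rewrite yL /= (le_trans Ls)|lra].
by rewrite -yE.
Qed.

Lemma locally_bounded_segment (R : realType) (L : R) (h : R -> R) : 0 <= L ->
  (forall t, 0 <= t <= L -> exists2 d, 0 < d & exists M, forall r,
     0 <= r <= L -> `|r - t| < d -> h r <= M) ->
  exists M, forall r, 0 <= r <= L -> h r <= M.
Proof.
move=> L0 hloc; apply: (@segment_propagation _ _
  (fun a b => exists M, forall r, a <= r <= b -> h r <= M)) => //.
  move=> a b c ab bc [M1 h1] [M2 h2]; exists (Num.max M1 M2) => r /andP[ar rc].
  rewrite le_max; case: (leP r b) => rb.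
    by rewrite h1 ?ar.
  by rewrite h2 ?orbT // rc ltW.
move=> t tL; have [d d0 [M hM]] := hloc t tL; exists d => // a b a0 at0 tb bL bad.
exists M => r /andP[ar rb]; apply: hM; first by apply/andP; split; lra.
by rewrite ltr_norml; apply/andP; split; lra.
Qed.

(** * Derivatives of vector-valued functions *)

Lemma subrBB (V : zmodType) (x y z w : V) : (x - y) - (z - w) = (x - z) - (y - w).
Proof. by rewrite opprD opprK addrACA opprD opprK. Qed.

Section Derivatives.
Variables (R : realType) (X : normedModType R[i]).
Implicit Types (g : R -> X) (v : X) (L t e : R).

(** Division-free, one-sided at 0 and L, with r = t allowed: remainders can be added and mapped
    without excluding the base point. *)
Definition has_deriv L g t v := forall e, 0 < e -> exists2 d, 0 < d & forall r,
  0 <= r <= L -> `|r - t| < d -> nrm (g r - g t - (r - t) *r v) <= e * `|r - t|.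

Lemma deriv_onP L g g' : deriv_on L g g' ->
  forall t, 0 <= t <= L -> has_deriv L g t (g' t).
Proof.
move=> dg t tL e e0; have ce0 : 0 < cR e by rewrite -cR0 cR_lt.
have /cvgrPdistC_le/(_ _ ce0) := dg t tL.
rewrite near_withinE => /nbhs_ballP[d /= d0 dP]; exists d => // r rL rt.
have [->|rNt] := eqVneq r t; first by rewrite !subrr scale0r !subr0 nrm0 normr0 mulr0.
have rt0 : r - t != 0 by rewrite subr_eq0.
have /dP : ball (0 : R) d (r - t) by rewrite -ball_normE /= sub0r normrN.
rewrite subrKC => /(_ (conj rt0 rL)); rewrite -cR_nrm cR_le => h.
have -> : g r - g t - (r - t) *r g' t =
    (r - t) *r ((r - t)^-1 *r (g r - g t) - g' t).
  by rewrite scalerBr scalerA -cRM divff // cR1 scale1r.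
by rewrite nrmZr mulrC ler_wpM2r.
Qed.

Lemma has_deriv_restrict L L' g t v : L' <= L -> has_deriv L g t v -> has_deriv L' g t v.
Proof.
move=> LL dg e /dg[d d0 dP]; exists d => // r /andP[r0 rL]; apply: dP.
by rewrite r0 (le_trans rL).
Qed.

Lemma has_deriv_shift L L' a g t v : 0 <= a -> a + L' <= L ->
  has_deriv L g (a + t) v -> has_deriv L' (fun r => g (a + r)) t v.
Proof.
move=> a0 aL dg e /dg[d d0 dP]; exists d => // r /andP[r0 rL].
have -> : r - t = (a + r) - (a + t) by lra.
by apply: dP; apply/andP; split; lra.
Qed.

Lemma has_derivB L g1 g2 t v1 v2 : has_deriv L g1 t v1 -> has_deriv L g2 t v2 ->
  has_deriv L (fun r => g1 r - g2 r) t (v1 - v2).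
Proof.
move=> d1 d2 e e0; have e20 : 0 < e / 2 by lra.
have [a a0 aP] := d1 _ e20; have [b b0 bP] := d2 _ e20.
exists (Num.min a b); first by rewrite lt_min a0.
move=> r rL; rewrite lt_min => /andP[/(aP _ rL) h1 /(bP _ rL) h2].
rewrite scalerBr; set w1 := _ *r v1 in h1 *; set w2 := _ *r v2 in h2 *.
have -> : g1 r - g2 r - (g1 t - g2 t) - (w1 - w2) =
  (g1 r - g1 t - w1) - (g2 r - g2 t - w2) by rewrite [RHS]subrBB; congr (_ - _); exact: subrBB.
apply: le_trans (nrmB _ _) _.
by apply: le_trans (lerD h1 h2) _; rewrite -mulrDl; lra.
Qed.

Lemma quadratic_has_deriv L g t v C :
  (forall r, 0 <= r <= L -> nrm (g r - g t - (r - t) *r v) <= C * (r - t) ^+ 2) ->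
  has_deriv L g t v.
Proof.
move=> h e e0; have C0 : 0 < `|C| + 1 by rewrite ltr_wpDl.
exists (e / (`|C| + 1)); first exact: divr_gt0.
move=> r rL; rewrite ltr_pdivlMr // => rt; apply: le_trans (h r rL) _.
rewrite -[(r - t) ^+ 2]real_normK ?num_real //.
rewrite expr2 mulrA ler_wpM2r // (le_trans _ (ltW rt)) // mulrC ler_wpM2l //.
by rewrite (le_trans (ler_norm C)) // lerDl.
Qed.

Definition bounded_seminorm (p : X -> R) :=
  [/\ forall x y, p (x + y) <= p x + p y,
      forall a x, p (a *r x) = `|a| * p x &
      exists C, forall x, p x <= C * nrm x].

Lemma seminormN p x : bounded_seminorm p -> p (- x) = p x.
Proof.
move=> [_ ph _]; have := ph (-1) x.
by rewrite cRN cR1 scaleN1r normrN1 mul1r.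
Qed.

(** Splitting an increment at t costs nothing, since |b - t| + |a - t| = b - a; the bound (K + e)(b
    - a) is additive and so passes from small intervals to [0, L]. The constant C comparing p with
    the norm only decides how small the remainder must be (e / C) and is gone once e tends to 0. *)
Lemma mean_value_seminorm p g g' L K : bounded_seminorm p -> 0 <= L ->
  (forall t, 0 <= t <= L -> has_deriv L g t (g' t)) ->
  (forall t, 0 <= t <= L -> p (g' t) <= K) ->
  p (g L - g 0) <= K * L.
Proof.
move=> psn L0 dg pK; have [pD pZ [C0 pC0]] := psn.
have [C C1 pC] : exists2 C, 0 < C & forall x, p x <= C * nrm x.
  exists (`|C0| + 1); first by rewrite ltr_wpDl.
  move=> x; apply: le_trans (pC0 x) _; rewrite ler_wpM2r ?nrm_ge0 //.
  by rewrite (le_trans (ler_norm _)) // lerDl.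
suff H e : 0 < e -> p (g L - g 0) <= (K + e) * L.
  apply/ler_addgt0Pr => e e0; have L1 : 0 < L + 1 by lra.
  apply: le_trans (H (e / (L + 1)) (divr_gt0 e0 L1)) _.
  rewrite mulrDl lerD2l mulrAC ler_pdivrMr // ler_wpM2l //; lra.
move=> e0; rewrite -{2}[L]subr0.
apply: (@segment_propagation _ _ (fun a b => p (g b - g a) <= (K + e) * (b - a))) => //.
  move=> a b c ab bc h1 h2.
  have -> : g c - g a = (g c - g b) + (g b - g a) by rewrite addrA subrK.
  by apply: le_trans (pD _ _) _; apply: le_trans (lerD h2 h1) _; lra.
move=> t tL; have [d d0 dP] := dg t tL _ (divr_gt0 e0 C1).
exists d => // a b a0 at0 tb bL bad.
have key r : 0 <= r <= L -> `|r - t| < d -> p (g r - g t) <= (K + e) * `|r - t|.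
  move=> rL rt; have -> : g r - g t = (g r - g t - (r - t) *r g' t) + (r - t) *r g' t.
    by rewrite subrK.
  apply: le_trans (pD _ _) _; rewrite addrC mulrDl lerD //.
    by rewrite pZ mulrC ler_wpM2r // pK.
  apply: le_trans (pC _) _; rewrite mulrC -ler_pdivlMr //.
  by rewrite mulrAC; apply: dP.
have -> : g b - g a = (g b - g t) + - (g a - g t) by rewrite opprB addrA subrK.
apply: le_trans (pD _ _) _; rewrite (seminormN _ psn).
have -> : (K + e) * (b - a) = (K + e) * `|b - t| + (K + e) * `|a - t|.
  by rewrite ger0_norm ?subr_ge0 // ler0_norm ?subr_le0 //; lra.
by apply: lerD; apply: key; try (apply/andP; split); rewrite ?ltr_norml; lra.
Qed.

End Derivatives.

(** * Scalar exponential series and remainders of powers *)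

Section ExponentialSeries.
Variables (R : realType).

Lemma exp_partial_sum_le (x : R) N : 0 <= x ->
  \sum_(m < N) x ^+ m / m`!%:R <= expR x.
Proof.
move=> x0; have -> : \sum_(m < N) x ^+ m / m`!%:R = series (exp_coeff x) N.
  by rewrite /series /= big_mkord.
apply: nondecreasing_cvgn_le; last exact: is_cvg_series_exp_coeff.
by apply: nondecreasing_series => n _ _; exact: exp_coeff_ge0.
Qed.

Lemma exp_partial_sum_cauchy (x e : R) : 0 <= x -> 0 < e ->
  exists N, forall n m, (N <= n)%N -> (n <= m)%N ->
  \sum_(n <= i < m) x ^+ i / i`!%:R <= e.
Proof.
move=> x0 e0; have /cvgrPdist_le/(_ _ e0)[N _ NP] : series (exp_coeff x) @ \oo --> expR x.
  exact: is_cvg_series_exp_coeff.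
exists N => n m Nn nm; have /= := NP n Nn.
apply: le_trans; rewrite ger0_norm; last first.
  by rewrite subr_ge0 /series /= big_mkord; exact: exp_partial_sum_le.
rewrite lerBrDr; apply: le_trans (exp_partial_sum_le m x0).
rewrite /series /= -(big_mkord xpredT (fun i => x ^+ i / i`!%:R)) (@big_cat_nat _ _ _ n 0 m) //=.
by rewrite addrC.
Qed.

(** The factor n + 1, linear in n, is chosen to cancel against (n + 1)! and leave an exponential
    series in 2M; the price is 2^n. In the induction M >= 1 absorbs M + 1 into 2M. *)
Lemma power_taylor2 (t s M : R) n : 1 <= M -> `|t| <= M -> `|s| <= M ->
  `|t ^+ n.+1 - s ^+ n.+1 - n.+1%:R * (t - s) * s ^+ n| <=
    n.+1%:R * (t - s) ^+ 2 * (2 * M) ^+ n.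
Proof.
move=> M1 tM sM; elim: n => [|n IH].
  by rewrite expr0 !expr1 mulr1 mul1r subrr normr0 !mul1r mulr1 sqr_ge0.
have -> : t ^+ n.+2 - s ^+ n.+2 - n.+2%:R * (t - s) * s ^+ n.+1 =
  t * (t ^+ n.+1 - s ^+ n.+1 - n.+1%:R * (t - s) * s ^+ n) +
  n.+1%:R * (t - s) ^+ 2 * s ^+ n.
  by rewrite !exprS -[n.+2]addn1 natrD; ring.
have nQ0 : 0 <= n.+1%:R * (t - s) ^+ 2 by apply: mulr_ge0 => //; exact: sqr_ge0.
apply: le_trans (ler_normD _ _) _.
rewrite (normrM t) (normrM (_ * _) (s ^+ n)) (ger0_norm nQ0).
have M0 : 0 <= M by lra.
have h1 : `|t| * `|t ^+ n.+1 - s ^+ n.+1 - n.+1%:R * (t - s) * s ^+ n| <=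
    M * (n.+1%:R * (t - s) ^+ 2 * (2 * M) ^+ n) by exact: ler_pM.
have h2 : n.+1%:R * (t - s) ^+ 2 * `|s ^+ n| <=
    n.+1%:R * (t - s) ^+ 2 * (2 * M) ^+ n.
  apply: ler_wpM2l => //.
  by rewrite normrX lerXn2r ?nnegrE //; lra.
apply: le_trans (lerD h1 h2) _.
set Q := (t - s) ^+ 2; set P := (2 * M) ^+ n.
have Q0 : 0 <= Q by exact: sqr_ge0.
have P0 : 0 <= P by apply: exprn_ge0; lra.
have -> : M * (n.+1%:R * Q * P) + n.+1%:R * Q * P = n.+1%:R * Q * ((M + 1) * P) by ring.
rewrite [leRHS]mulrC exprS -/P [leRHS]mulrC.
apply: ler_pM.
- exact: mulr_ge0.
- by apply: mulr_ge0 => //; lra.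
- by rewrite ler_wpM2r // ler_nat.
- rewrite ler_wpM2r //; lra.
Qed.

End ExponentialSeries.

(** * Exponentials of bounded operators *)

Section ExponentialGeneratingFunctions.
Variables (R : realType) (X : completeNormedModType R[i]).
Implicit Types (a : nat -> X) (t K b M : R).

(** Exponential generating functions: differentiation is the shift of the coefficients.
    Exponentials, phi-functions and Taylor polynomials are all of this form, so one convergence
    proof and one remainder estimate serve them all. *)
Definition egf_sum a t N : X := \sum_(m < N) cR (t ^+ m / (m`!)%:R) *: a m.
Definition egf a t : X := lim (egf_sum a t @ \oo).
Definition geom_bounded K b a :=
  [/\ 0 <= K, 0 <= b & forall n, nrm (a n) <= K * b ^+ n].

Lemma egf_term_le K b a t m : geom_bounded K b a ->
  nrm (cR (t ^+ m / (m`!)%:R) *: a m) <= K * ((`|t| * b) ^+ m / m`!%:R).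
Proof.
move=> [K0 b0 ab]; rewrite nrmZr normrM normrX normfV (@ger0_norm _ m`!%:R) //.
have -> : K * ((`|t| * b) ^+ m / m`!%:R) = `|t| ^+ m / m`!%:R * (K * b ^+ m).
  by rewrite exprMn; ring.
by rewrite ler_wpM2l // divr_ge0 ?exprn_ge0.
Qed.

Lemma egf_cvg K b a t : geom_bounded K b a -> egf_sum a t @ \oo --> egf a t.
Proof.
move=> ab; have [K0 b0 _] := ab; apply: cvg_cauchy_nrm => e e0.
have K1 : 0 < K + 1 by lra.
have tb : 0 <= `|t| * b by exact: mulr_ge0.
have [N NP] := exp_partial_sum_cauchy tb (divr_gt0 e0 K1).
exists N => n m Nn nm; rewrite /egf_sum.
rewrite -!(big_mkord xpredT (fun i => cR (t ^+ i / i`!%:R) *: a i)).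
rewrite (@big_cat_nat _ _ _ n 0 m) //= [X in nrm X]addrC addKr.
apply: le_trans (nrm_sum _ _) _.
apply: le_trans (ler_sum _ (fun i _ => egf_term_le t i ab)) _.
rewrite -mulr_sumr; have := NP n m Nn nm; rewrite ler_pdivlMr //.
apply: le_trans; rewrite mulrC ler_wpM2l ?lerDl //.
by apply: sumr_ge0 => i _; rewrite divr_ge0 ?exprn_ge0.
Qed.

Arguments egf_cvg {K b a} t _.

Lemma egf_unique a t x : egf_sum a t @ \oo --> x -> egf a t = x.
Proof. by move/cvg_lim; apply; exact: norm_hausdorff. Qed.

Lemma egf_le K b a t : geom_bounded K b a -> nrm (egf a t) <= K * expR (`|t| * b).
Proof.
move=> ab; have [K0 b0 _] := ab; apply: (nrm_lim_le (egf_cvg t ab)) => N.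
apply: le_trans (nrm_sum _ _) _.
apply: le_trans (ler_sum _ (fun (i : 'I_N) _ => egf_term_le t i ab)) _.
by rewrite -mulr_sumr ler_wpM2l // exp_partial_sum_le // mulr_ge0.
Qed.

Lemma geom_bounded_shift K b a : geom_bounded K b a ->
  geom_bounded (K * b) b (fun n => a n.+1).
Proof.
move=> [K0 b0 ab]; split=> //; first exact: mulr_ge0.
by move=> n; rewrite -mulrA -exprS.
Qed.

Lemma cvgn_succ (x_ : nat -> X) (x : X) : x_ @ \oo --> x -> (fun n => x_ n.+1) @ \oo --> x.
Proof. by rewrite (cvg_shiftS x_). Qed.

Lemma egf_taylor2 K b M a t s : geom_bounded K b a -> 1 <= M -> `|t| <= M -> `|s| <= M ->
  nrm (egf a t - egf a s - (t - s) *r egf (fun n => a n.+1) s) <=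
    K * b * expR (2 * M * b) * (t - s) ^+ 2.
Proof.
move=> ab M1 tM sM; have [K0 b0 abd] := ab; have ab' := geom_bounded_shift ab.
have M0 : 0 <= M by lra.
(* The shift consumes one coefficient: N + 1 terms of the function match N terms of the derivative,
   and the constant term cancels in the difference. *)
pose D N := egf_sum a t N.+1 - egf_sum a s N.+1 - (t - s) *r egf_sum (fun n => a n.+1) s N.
apply: (@nrm_lim_le _ _ D).
  apply: cvgB; first apply: cvgB.
  - exact: cvgn_succ (egf_cvg t ab).
  - exact: cvgn_succ (egf_cvg s ab).
  - by apply: cvgZ; [exact: cvg_cst|exact: (egf_cvg s ab')].
move=> N; pose q n := t ^+ n.+1 - s ^+ n.+1 - n.+1%:R * (t - s) * s ^+ n.
have -> : D N = \sum_(m < N) cR (q m / m.+1`!%:R) *: a m.+1.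
  rewrite /D /egf_sum -sumrB big_ord_recl /= !expr0 subrr add0r scaler_sumr -sumrB.
  apply: eq_bigr => i _; rewrite scalerA -cRM -!scalerBl -!cRB /bump /= add1n.
  congr (cR _ *: _); rewrite /q factS natrM; field.
  by rewrite addrC natr1 !pnatr_eq0 -lt0n fact_gt0.
apply: le_trans (nrm_sum _ _) _.
have h : forall i : 'I_N, true -> nrm (cR (q i / i.+1`!%:R) *: a i.+1) <=
    K * b * (t - s) ^+ 2 * ((2 * M * b) ^+ i / i`!%:R).
  move=> i _; rewrite nrmZr normrM normfV (@ger0_norm _ i.+1`!%:R) //.
  have qi := power_taylor2 i M1 tM sM; rewrite -/(q i) in qi.
  have f0 : 0 < i.+1`!%:R :> R by rewrite ltr0n fact_gt0.
  have h1 : `|q i| / i.+1`!%:R <= (t - s) ^+ 2 * ((2 * M) ^+ i / i`!%:R).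
    rewrite ler_pdivrMr //; apply: le_trans qi _.
    rewrite le_eqVlt; apply/orP; left; apply/eqP.
    rewrite factS natrM; field.
    by rewrite pnatr_eq0 -lt0n fact_gt0.
  have -> : K * b * (t - s) ^+ 2 * ((2 * M * b) ^+ i / i`!%:R) =
      (t - s) ^+ 2 * ((2 * M) ^+ i / i`!%:R) * (K * b ^+ i.+1).
    by rewrite exprMn (exprS b); ring.
  apply: ler_pM (nrm_ge0 _) h1 (abd _).
  by apply: divr_ge0.
apply: le_trans (ler_sum _ h) _; rewrite -mulr_sumr mulrAC ler_wpM2r ?sqr_ge0 //.
rewrite ler_wpM2l ?mulr_ge0 // exp_partial_sum_le // mulr_ge0 //; lra.
Qed.

Lemma egf0 a : egf a 0 = a 0%N.
Proof.
apply: egf_unique; apply/cvg_nrmP => e e0; exists 1%N => -[//|n] _.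
rewrite /egf_sum big_ord_recl /= expr0 fact0 divr1 cR1 scale1r big1 ?addr0 ?subrr ?nrm0 ?ltW //.
by move=> i _; rewrite exprS mul0r mul0r cR0 scale0r.
Qed.

Lemma egfD K1 b1 a1 K2 b2 a2 t : geom_bounded K1 b1 a1 -> geom_bounded K2 b2 a2 ->
  egf (fun n => a1 n + a2 n) t = egf a1 t + egf a2 t.
Proof.
move=> h1 h2; apply: egf_unique; rewrite (_ : egf_sum _ t = egf_sum a1 t \+ egf_sum a2 t).
  by apply: cvgD; [exact: egf_cvg h1|exact: egf_cvg h2].
by apply/funext => N; rewrite /= /egf_sum -big_split /=; apply: eq_bigr => i _; rewrite scalerDr.
Qed.

Lemma egf_single t j (y : X) :
  egf (fun n => if n == j then y else 0) t = (t ^+ j / j`!%:R) *r y.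
Proof.
apply: egf_unique; apply/cvg_nrmP => e e0; exists j.+1 => n jn.
rewrite /egf_sum (bigD1 (Ordinal jn)) //= eqxx big1 ?addr0 ?subrr ?nrm0 ?ltW // => i ij.
by case: eqP => [ij'|]; [case/eqP: ij; exact: val_inj|rewrite scaler0].
Qed.

End ExponentialGeneratingFunctions.
Arguments egf_cvg {R X K b a} t _.

Section LinearOn.
Variables (R : realType) (X Y : normedModType R[i]) (F : X -> Y).
Hypothesis Flin : linear_on setT F.

Lemma linear_onD x y : F (x + y) = F x + F y.
Proof. by have := @Flin 1 x y I I; rewrite !scale1r. Qed.

Lemma linear_on0 : F 0 = 0.
Proof. by apply: (addrI (F 0)); rewrite -linear_onD !addr0. Qed.

Lemma linear_onZ (a : R[i]) x : F (a *: x) = a *: F x.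
Proof. by have := @Flin a x 0 I I; rewrite linear_on0 !addr0. Qed.

Lemma linear_onB x y : F (x - y) = F x - F y.
Proof. by rewrite linear_onD -scaleN1r linear_onZ scaleN1r. Qed.

Lemma linear_on_sum I r (f : I -> X) : F (\sum_(i <- r) f i) = \sum_(i <- r) F (f i).
Proof.
elim: r => [|i r IH]; first by rewrite !big_nil linear_on0.
by rewrite !big_cons linear_onD IH.
Qed.

Lemma linear_on_has_deriv K L (g : R -> X) t v :
  (forall x, nrm (F x) <= K * nrm x) ->
  has_deriv L g t v -> has_deriv L (fun r => F (g r)) t (F v).
Proof.
move=> FK dg e e0; have K0 : 0 < `|K| + 1 by rewrite ltr_wpDl.
have [d d0 dP] := dg _ (divr_gt0 e0 K0); exists d => // r rL rt.
rewrite -linear_onZ -!linear_onB; apply: le_trans (FK _) _.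
have := dP r rL rt; rewrite -(ler_pM2l K0) mulrA (mulrC _ (e / _)) divfK ?gt_eqF //.
by apply: le_trans; rewrite ler_wpM2r ?nrm_ge0 // (le_trans (ler_norm K)) // lerDl.
Qed.

End LinearOn.

Lemma egf_map (R : realType) (X : completeNormedModType R[i]) (F : X -> X) K K0 b
    (a : nat -> X) t :
  linear_on setT F -> (forall x, nrm (F x) <= K * nrm x) -> geom_bounded K0 b a ->
  F (egf a t) = egf (fun n => F (a n)) t.
Proof.
move=> Flin FK ab; apply/esym/egf_unique/cvg_nrmP => e e0.
have K1 : 0 < `|K| + 1 by rewrite ltr_wpDl.
have /cvg_nrmP/(_ _ (divr_gt0 e0 K1))[N NP] := egf_cvg t ab.
exists N => n /NP h.
have -> : egf_sum (fun m => F (a m)) t n = F (egf_sum a t n).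
  by rewrite (linear_on_sum Flin); apply: eq_bigr => i _; rewrite (linear_onZ Flin).
rewrite -(linear_onB Flin); apply: le_trans (FK _) _.
move: h; rewrite ler_pdivlMr // mulrC; apply: le_trans.
by rewrite ler_wpM2r ?nrm_ge0 // (le_trans (ler_norm K)) // lerDl.
Qed.

Section OperatorExponential.
Variables (R : realType) (X : completeNormedModType R[i]) (B : X -> X) (beta : R).
Hypotheses (Blin : linear_on setT B) (beta1 : 1 <= beta).
Hypothesis B_le : forall x, nrm (B x) <= beta * nrm x.
Implicit Types (x y : X) (t : R).

Let beta0 : 0 <= beta. Proof. exact: le_trans ler01 beta1. Qed.

Lemma iter_le n y : nrm (iter n B y) <= beta ^+ n * nrm y.
Proof.
elim: n => [|n IH]; first by rewrite expr0 mul1r.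
by rewrite iterS exprS -mulrA; apply: le_trans (B_le _) _; rewrite ler_wpM2l.
Qed.

Lemma iter_linear n : linear_on setT (iter n B).
Proof.
move=> a x y _ _; elim: n => [//|n IH].
by rewrite !iterS IH Blin.
Qed.

(* [epow j t y] is the sum of t^n / n! B^(n - j) y over n >= j, that is t^j phi_j(tB) y. *)
Definition epow_coef j y n := if (n < j)%N then 0 else iter (n - j) B y.

Definition epow j t y := egf (epow_coef j y) t.

Lemma epow_coef_geom j y : geom_bounded (nrm y) beta (epow_coef j y).
Proof.
split; [exact: nrm_ge0|by []|move=> n; rewrite /epow_coef mulrC].
case: ifP => _; first by rewrite nrm0 mulr_ge0 ?exprn_ge0 ?nrm_ge0.
apply: le_trans (iter_le _ _) _; rewrite ler_wpM2r ?nrm_ge0 //.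
by rewrite ler_weXn2l // leq_subr.
Qed.

Lemma opexpE t y : opexp B t y = epow 0 t y.
Proof.
rewrite /opexp /epow /egf /egf_sum; congr (lim (_ @ \oo)); apply/funext => N.
by apply: eq_bigr => i _; rewrite /epow_coef subn0.
Qed.

Lemma epow_le j t y : nrm (epow j t y) <= expR (`|t| * beta) * nrm y.
Proof. by rewrite mulrC; apply: egf_le; exact: epow_coef_geom. Qed.

Lemma epow_linear j t : linear_on setT (epow j t).
Proof.
move=> a x y _ _; apply: egf_unique.
rewrite (_ : egf_sum _ t = (fun N => a *: egf_sum (epow_coef j x) t N + egf_sum (epow_coef j y) t N)).
  apply: cvgD; last exact: (egf_cvg t (epow_coef_geom j y)).
  by apply: cvgZ; [exact: cvg_cst|exact: (egf_cvg t (epow_coef_geom j x))].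
apply/funext => N; rewrite /egf_sum scaler_sumr -big_split /=; apply: eq_bigr => i _.
rewrite /epow_coef; case: ifP => _; first by rewrite !scaler0 addr0.
by rewrite iter_linear // scalerDr !scalerA mulrC.
Qed.

Lemma epow_taylor2 j t s M y : 1 <= M -> `|t| <= M -> `|s| <= M ->
  nrm (epow j.+1 t y - epow j.+1 s y - (t - s) *r epow j s y) <=
    beta * expR (2 * M * beta) * (t - s) ^+ 2 * nrm y.
Proof.
move=> M1 tM sM; have := egf_taylor2 (epow_coef_geom j.+1 y) M1 tM sM.
have -> : (fun n => epow_coef j.+1 y n.+1) = epow_coef j y.
  by apply/funext => n; rewrite /epow_coef ltnS subSS.
by move=> h; apply: le_trans h _; rewrite le_eqVlt; apply/orP; left; apply/eqP; ring.
Qed.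

(** At level 0 the shifted coefficients B^{n+1} y are those of B y, so differentiation produces B;
    at higher levels it merely lowers the index. *)
Lemma opexp_taylor2 t s M y : 1 <= M -> `|t| <= M -> `|s| <= M ->
  nrm (epow 0 t y - epow 0 s y - (t - s) *r epow 0 s (B y)) <=
    beta * expR (2 * M * beta) * (t - s) ^+ 2 * nrm y.
Proof.
move=> M1 tM sM; have := egf_taylor2 (epow_coef_geom 0 y) M1 tM sM.
have -> : (fun n => epow_coef 0 y n.+1) = epow_coef 0 (B y).
  by apply/funext => n; rewrite /epow_coef !subn0 iterSr.
by move=> h; apply: le_trans h _; rewrite le_eqVlt; apply/orP; left; apply/eqP; ring.
Qed.

Lemma epow0 y : epow 0 0 y = y.
Proof. by rewrite /epow egf0. Qed.

Lemma epowS0 j y : epow j.+1 0 y = 0.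
Proof. by rewrite /epow egf0. Qed.

(** This is phi_j(z) = 1/j! + z phi_{j+1}(z), multiplied by t^j. As [epow j] is the derivative of
    [epow j.+1], it is also the differential equation of [epow j.+1] with source t^j/j! y. *)
Lemma epow_rec j t y : epow j t y = (t ^+ j / j`!%:R) *r y + B (epow j.+1 t y).
Proof.
rewrite (egf_map t Blin B_le (epow_coef_geom j.+1 y)) -egf_single /epow.
have g1 : geom_bounded (nrm y) beta (fun n => if n == j then y else 0).
  split => //; first exact: nrm_ge0.
  move=> n; case: eqP => _; last by rewrite nrm0 mulr_ge0 ?exprn_ge0 ?nrm_ge0.
  by rewrite ler_peMr ?nrm_ge0 // exprn_ege1.
have g2 : geom_bounded (nrm y * beta) beta (fun n => B (epow_coef j.+1 y n)).
  have [h1 h2 h3] := epow_coef_geom j.+1 y; split=> //; first exact: mulr_ge0.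
  move=> n; apply: le_trans (B_le _) _.
  by rewrite (mulrC _ beta) -mulrA ler_wpM2l.
rewrite -(egfD t g1 g2); congr (egf _ t); apply/funext => n; rewrite /epow_coef ltnS.
case: ltngtP => nj; rewrite ?(linear_on0 Blin) ?addr0 //.
  by rewrite add0r -iterS -subSn // subSS.
by rewrite nj subnn.
Qed.

(* Leibniz rule for [tau |-> exp((t - tau) B) (w tau)], in finite increment form. *)
Lemma opexp_conv_taylor t : 0 <= t -> exists2 C, 0 <= C & forall q r wq wr w'q,
  0 <= q <= t -> 0 <= r <= t ->
  nrm (epow 0 (t - r) wr - epow 0 (t - q) wq - (r - q) *r epow 0 (t - q) (w'q - B wq)) <=
  C * (nrm (wr - wq - (r - q) *r w'q) + (r - q) ^+ 2 * (nrm wq + nrm w'q)).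
Proof.
move=> t0; pose M := t + 1; pose C1 := expR (M * beta); pose C2 := beta * expR (2 * M * beta).
have C10 : 0 <= C1 by exact: expR_ge0.
have C20 : 0 <= C2 by rewrite mulr_ge0 ?expR_ge0.
have bound u y : 0 <= u <= t -> nrm (epow 0 u y) <= C1 * nrm y.
  move=> /andP[u0 ut]; apply: le_trans (epow_le _ _ _) _.
  rewrite ler_wpM2r ?nrm_ge0 // ler_expR ler_wpM2r // ger0_norm // /M; lra.
exists (C1 + C2 + (C1 * beta + C2 * M)) => [|q r wq wr w'q /andP[q0 qt] /andP[r0 rt]].
  have M0 : 0 <= M by rewrite /M; lra.
  by rewrite !addr_ge0 // mulr_ge0.
have E := epow_linear 0.
have sub_in u : 0 <= u -> u <= t -> 0 <= t - u <= t by move=> *; apply/andP; split; lra.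
have subM u : 0 <= u -> u <= t -> `|t - u| <= M.
  by move=> *; rewrite ger0_norm /M; lra.
have M1 : 1 <= M by rewrite /M; lra.
have rqE : (t - r) - (t - q) = - (r - q) by ring.
set P := epow 0 (t - r) wr - _ - _.
(* Three contributions: the remainder of w, the remainder of the exponential at [wq], and a cross
   term that is quadratic because the exponential is Lipschitz in time. *)
have PE : P = epow 0 (t - r) (wr - wq - (r - q) *r w'q)
  + (epow 0 (t - r) wq - epow 0 (t - q) wq + (r - q) *r epow 0 (t - q) (B wq))
  + (r - q) *r (epow 0 (t - r) w'q - epow 0 (t - q) w'q).
  rewrite /P !(linear_onB (E _)) (linear_onZ (E _)) !scalerBr.
  set a := epow 0 (t - r) wr; set b := epow 0 (t - q) wq; set c := _ *r epow 0 (t - q) w'q.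
  set d := _ *r epow 0 (t - q) (B wq); set e := epow 0 (t - r) wq; set f := _ *r epow 0 (t - r) w'q.
  have -> : a - e - f + (e - b + d) = (a - b + d) - f.
    by rewrite addrAC; congr (_ - _); rewrite -addrA; rewrite (addrA (- e)) (addrA (- e)) addNr add0r addrA.
  by rewrite addrA subrK opprB (addrC d) addrA addrAC.
have h1 := bound _ (wr - wq - (r - q) *r w'q) (sub_in r r0 rt).
have h2 := opexp_taylor2 wq M1 (subM r r0 rt) (subM q q0 qt).
rewrite rqE cRN scaleNr opprK sqrrN -/C2 in h2.
have h3 : nrm ((r - q) *r (epow 0 (t - r) w'q - epow 0 (t - q) w'q)) <=
    (C1 * beta + C2 * M) * (r - q) ^+ 2 * nrm w'q.
  have := opexp_taylor2 w'q M1 (subM r r0 rt) (subM q q0 qt); rewrite rqE sqrrN -/C2.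
  set d := epow 0 (t - r) w'q - _; set z := _ *r _ => h.
  have dn : nrm d <= C2 * (r - q) ^+ 2 * nrm w'q + `|r - q| * (C1 * (beta * nrm w'q)).
    have -> : d = (d - z) + z by rewrite subrK.
    apply: le_trans (nrmD _ _) _; apply: lerD => //.
    rewrite nrmZr normrN ler_wpM2l //; apply: le_trans (bound _ _ (sub_in q q0 qt)) _.
    by rewrite ler_wpM2l.
  rewrite nrmZr; apply: le_trans (ler_wpM2l (normr_ge0 _) dn) _.
  rewrite -[(r - q) ^+ 2]real_normK ?num_real //.
  have rqM : `|r - q| <= M by rewrite ler_norml /M; apply/andP; split; lra.
  have -> : `|r - q| * (C2 * `|r - q| ^+ 2 * nrm w'q + `|r - q| * (C1 * (beta * nrm w'q))) =
    (C1 * beta + C2 * `|r - q|) * `|r - q| ^+ 2 * nrm w'q by ring.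
  by rewrite ler_wpM2r ?nrm_ge0 // ler_wpM2r ?sqr_ge0 // lerD2l ler_wpM2l.
rewrite PE; apply: le_trans (nrmD _ _) _; apply: le_trans (lerD (nrmD _ _) (lexx _)) _.
apply: le_trans (lerD (lerD h1 h2) h3) _.
set N1 := nrm _; set Q := _ ^+ 2; set n1 := nrm wq; set n2 := nrm w'q; set C3 := _ + _ * M.
have N10 : 0 <= N1 by exact: nrm_ge0.
have n10 : 0 <= n1 by exact: nrm_ge0.
have n20 : 0 <= n2 by exact: nrm_ge0.
have Q0 : 0 <= Q by exact: sqr_ge0.
have C30 : 0 <= C3 by rewrite addr_ge0 // mulr_ge0 //; lra.
rewrite -subr_ge0.
have -> : (C1 + C2 + C3) * (N1 + Q * (n1 + n2)) - (C1 * N1 + C2 * Q * n1 + C3 * Q * n2) =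
  C2 * N1 + C3 * N1 + C1 * (Q * (n1 + n2)) + C2 * (Q * n2) + C3 * (Q * n1) by ring.
by do !apply: addr_ge0; do !apply: mulr_ge0 => //; exact: addr_ge0.
Qed.

Lemma opexp_conv_has_deriv t w w' q : 0 <= t -> 0 <= q <= t -> has_deriv t w q w' ->
  has_deriv t (fun r => epow 0 (t - r) (w r)) q (epow 0 (t - q) (w' - B (w q))).
Proof.
move=> t0 qt dw e e0; have [C C0 CP] := opexp_conv_taylor t0.
pose n := nrm (w q) + nrm w' + 1.
have n0 : 0 < n by rewrite /n ltr_wpDl // addr_ge0 // nrm_ge0.
pose e' := e / (2 * (C + 1)).
have e'0 : 0 < e' by rewrite divr_gt0 //; lra.
have [d d0 dP] := dw _ e'0; exists (Num.min d (e' / n)).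
  by rewrite lt_min d0 divr_gt0.
move=> r rt; rewrite lt_min => /andP[/(dP _ rt) h1]; rewrite ltr_pdivlMr // => h2.
apply: le_trans (CP q r _ _ _ qt rt) _.
have h3 : (r - q) ^+ 2 * (nrm (w q) + nrm w') <= e' * `|r - q|.
  rewrite -[(r - q) ^+ 2]real_normK ?num_real // expr2 -mulrA mulrC ler_wpM2r //.
  apply: le_trans (ltW h2); rewrite ler_wpM2l // /n; lra.
apply: le_trans (ler_wpM2l C0 (lerD h1 h3)) _.
rewrite -mulrDl mulrA ler_wpM2r //.
have -> : C * (e' + e') = e * (C / (C + 1)) by rewrite /e'; field; lra.
by rewrite ger_pMr // ler_pdivrMr; lra.
Qed.

(** The hypothesis measures the propagated residual as a whole. For the mesh seminorm this bound
    comes from the stability of the exponential, so that [beta] stays out of the conclusion. *)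
Lemma duhamel_le (p : X -> R) v v' k K : bounded_seminorm p -> 0 <= k ->
  (forall t, 0 <= t <= k -> has_deriv k v t (v' t)) ->
  (forall t, 0 <= t <= k -> p (epow 0 (k - t) (v' t - B (v t))) <= K) ->
  p (v k - epow 0 k (v 0)) <= K * k.
Proof.
move=> psn k0 dv pK.
have := @mean_value_seminorm _ _ p (fun r => epow 0 (k - r) (v r)) _ _ _ psn k0
  (fun t tk => opexp_conv_has_deriv k0 tk (dv t tk)) pK.
by rewrite /= subrr epow0 subr0.
Qed.

Lemma nrm_bounded_seminorm : bounded_seminorm (@nrm R X).
Proof.
split; [exact: nrmD|exact: nrmZr|by exists 1 => x; rewrite mul1r].
Qed.

Lemma opexp_has_deriv L t y : 0 <= L -> 0 <= t <= L ->
  has_deriv L (fun r => epow 0 r y) t (epow 0 t (B y)).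
Proof.
move=> L0 /andP[t0 tL]; apply: quadratic_has_deriv => r /andP[r0 rL].
rewrite [_ * _ ^+ 2](_ : _ = beta * expR (2 * (L + 1) * beta) * (r - t) ^+ 2 * nrm y).
  by apply: opexp_taylor2; rewrite ?ger0_norm; lra.
by rewrite mulrAC.
Qed.

Lemma epow_comm t y : epow 0 t (B y) = B (epow 0 t y).
Proof.
rewrite (egf_map t Blin B_le (epow_coef_geom 0 y)); congr (egf _ t).
by apply/funext => n; rewrite /epow_coef -iterSr.
Qed.

(** Uniqueness in place of a Cauchy product: s -> e^{(r+s)B} y solves v' = Bv, and Duhamel with zero
    residual identifies it with the exponential of its initial value. *)
Lemma epow_semigroup t r y : 0 <= t -> 0 <= r ->
  epow 0 (t + r) y = epow 0 t (epow 0 r y).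
Proof.
move=> t0 r0; apply/subr0_eq/nrm_eq0/le_anti; rewrite nrm_ge0 andbT.
have := @duhamel_le (@nrm R X) (fun s => epow 0 (r + s) y)
   (fun s => epow 0 (r + s) (B y)) t 0 nrm_bounded_seminorm t0.
rewrite mul0r (addrC t) addr0; apply.
  move=> s /andP[s0 st]; apply: (@has_deriv_shift _ _ (r + t)) => //.
  by apply: opexp_has_deriv; [lra|apply/andP; split; lra].
move=> s _; rewrite epow_comm subrr (linear_on0 (epow_linear _ _)) nrm0 //.
Qed.

(** The increment of g telescopes over the n + 1 subintervals, each leaving a remainder C
    (t/(n+1))^2; the total C t^2/(n+1) tends to 0. *)
Lemma riemann_sum_cvg (g g' : R -> X) C t : 0 <= t ->
  (forall q r, 0 <= q <= t -> 0 <= r <= t ->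
    nrm (g r - g q - (r - q) *r g' q) <= C * (r - q) ^+ 2) ->
  rint t g' = g t - g 0.
Proof.
move=> t0 gC; rewrite /rint; apply/cvg_lim; first exact: norm_hausdorff.
apply/cvg_nrmP => e e0.
pose N := Num.truncn (`|C| * t ^+ 2 / e); exists N => n Nn.
have n0 : 0 < n.+1%:R :> R by rewrite ltr0n.
pose x (i : nat) := t * i%:R / n.+1%:R.
have xi i : (i <= n.+1)%N -> 0 <= x i <= t.
  move=> ni; rewrite divr_ge0 ?mulr_ge0 //= ler_pdivrMr // ler_wpM2l // ler_nat //.
have dx i : x i.+1 - x i = t / n.+1%:R by rewrite /x -natr1; field; rewrite addrC natr1 pnatr_eq0.
have -> : g t - g 0 = \sum_(i < n.+1) (g (x i.+1) - g (x i)).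
  rewrite -(big_mkord xpredT (fun i => g (x i.+1) - g (x i))) telescope_sumr //.
  by rewrite /x mulr0 mul0r mulfK // gt_eqF.
rewrite nrm_distC scaler_sumr -sumrB; apply: le_trans (nrm_sum _ _) _.
have h : forall i : 'I_n.+1, true ->
    nrm (g (x i.+1) - g (x i) - (t / n.+1%:R) *r g' (t * i%:R / n.+1%:R)) <=
    `|C| * (t / n.+1%:R) ^+ 2.
  move=> i _; rewrite -(dx i); apply: le_trans (gC _ _ _ _) _.
  - by apply: xi; exact: ltnW.
  - by apply: xi; exact: ltn_ord.
  - by rewrite ler_wpM2r ?sqr_ge0 // ler_norm.
apply: le_trans (ler_sum _ h) _; rewrite sumr_const card_ord -[_ *+ n.+1]mulr_natr.
have -> : `|C| * (t / n.+1%:R) ^+ 2 * n.+1%:R = `|C| * t ^+ 2 / n.+1%:R.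
  by field; rewrite addrC natr1 pnatr_eq0.
rewrite ler_pdivrMr // [e * _]mulrC -ler_pdivrMr //.
by apply: le_trans (ltW (truncnS_gt _)) _; rewrite ler_nat ltnS.
Qed.

(* [exp((t - tau) B) E_{j+1}(tau)] is an antiderivative of the integrand of phi_{j+1}. *)
Lemma rint_epow j t y : 0 <= t ->
  rint t (fun tau => cR (tau ^+ j / (j`!)%:R) *: opexp B (t - tau) y) = epow j.+1 t y.
Proof.
move=> t0; have [C C0 CP] := opexp_conv_taylor t0.
pose M := t + 1; pose C2 := beta * expR (2 * M * beta) * nrm y.
pose C1 := expR (M * beta) * nrm y.
(* By [epow_rec] the factor tau^j/j! y is w' - B w for w = [epow j.+1], so the integrand becomes the
   Leibniz derivative of e^{(t - tau)B} w(tau). *)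
have -> : (fun tau => cR (tau ^+ j / (j`!)%:R) *: opexp B (t - tau) y) =
   (fun tau => epow 0 (t - tau) (epow j tau y - B (epow j.+1 tau y))).
  apply/funext => tau; rewrite (epow_rec j) addrK.
  by rewrite (linear_onZ (epow_linear _ _)) opexpE.
rewrite (@riemann_sum_cvg (fun tau => epow 0 (t - tau) (epow j.+1 tau y)) _ (C * (C2 + (C1 + C1)))) //.
  by rewrite subrr epow0 epowS0 (linear_on0 (epow_linear _ _)) subr0.
move=> q r qt rt; apply: le_trans (CP q r _ _ _ qt rt) _.
rewrite -[leRHS]mulrA ler_wpM2l //.
have bound i : nrm (epow i q y) <= C1.
  apply: le_trans (epow_le _ _ _) _; rewrite ler_wpM2r ?nrm_ge0 // ler_expR ler_wpM2r //.
  move/andP: qt => [q0 qt]; rewrite ger0_norm // /M; lra.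
rewrite mulrDl; apply: lerD; last first.
  by rewrite mulrC ler_wpM2r ?sqr_ge0 // lerD.
rewrite mulrAC; apply: epow_taylor2; rewrite /M; [lra| |].
  by move/andP: rt => [r0 rt]; rewrite ger0_norm; lra.
by move/andP: qt => [q0 qt]; rewrite ger0_norm; lra.
Qed.

Lemma phi_epow j k y : 0 < k -> phi j.+1 B k y = (k ^- j.+1) *r epow j.+1 k y.
Proof. by move=> k0; rewrite /phi rint_epow // ltW. Qed.

End OperatorExponential.

(** * Finite-dimensional subspaces *)

(* Spans are taken over the reals so that the unit sphere of coordinates is compact in
   the library; a complex family b is replaced by b together with i b. *)
Section RealSpan.
Variables (R : realType) (X : normedModType R[i]).
Implicit Types (l : seq X) (x y : X) (a : R).

Fixpoint rspan l x : Prop :=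
  if l is y :: l' then exists a, rspan l' (x - a *r y) else x = 0.

Fixpoint rfree l : Prop :=
  if l is y :: l' then ~ rspan l' y /\ rfree l' else True.

Lemma rspan0 l : rspan l 0.
Proof. by elim: l => [//|y l IH]; exists 0; rewrite scale0r subr0. Qed.

Lemma rspanD l x y : rspan l x -> rspan l y -> rspan l (x + y).
Proof.
elim: l x y => [|z l IH] x y /=; first by move=> -> ->; rewrite addr0.
by move=> [a xa] [b yb]; exists (a + b); rewrite cRD scalerDl opprD addrACA; exact: IH.
Qed.

Lemma rspanZ l a x : rspan l x -> rspan l (a *r x).
Proof.
elim: l x => [|z l IH] x /=; first by move=> ->; rewrite scaler0.
by move=> [b xb]; exists (a * b); rewrite cRM -scalerA -scalerBr; exact: IH.
Qed.

Lemma rspan_mem l y : y \in l -> rspan l y.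
Proof.
elim: l => [//|z l IH]; rewrite inE => /orP[/eqP->|yl] /=.
  by exists 1; rewrite cR1 scale1r subrr; exact: rspan0.
by exists 0; rewrite scale0r subr0; exact: IH.
Qed.

Lemma rspan_lincomb l x : rspan l x ->
  exists v : nat -> R, x = \sum_(i < size l) v i *r l`_i.
Proof.
elim: l x => [|y l IH] x /=; first by move=> ->; exists (fun=> 0); rewrite big_ord0.
move=> [a /IH[v xv]]; exists (fun i => if i is j.+1 then v j else a).
by rewrite big_ord_recl /= -xv addrC subrK.
Qed.

Lemma lincomb_rspan l (v : nat -> R) : rspan l (\sum_(i < size l) v i *r l`_i).
Proof.
elim/big_ind: _ => [|x y|i _]; [exact: rspan0|exact: rspanD|].
by apply/rspanZ/rspan_mem/mem_nth.
Qed.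

Lemma rfree_lincomb0 l (v : nat -> R) : rfree l ->
  \sum_(i < size l) v i *r l`_i = 0 -> forall i, (i < size l)%N -> v i = 0.
Proof.
elim: l v => [//|y l IH] v /= [yl lf]; rewrite big_ord_recl /=.
under eq_bigr do rewrite /bump /= add1n.
move=> v0; have vz : v 0%N = 0.
  apply/eqP; apply: contraPT yl => vN /=; apply.
  have -> : y = (- (v 0%N)^-1) *r (\sum_(i < size l) v i.+1 *r l`_i).
    have -> : \sum_(i < size l) v i.+1 *r l`_i = - (v 0%N *r y).
      by apply/eqP; rewrite -addr_eq0 addrC; apply/eqP.
    by rewrite cRN scaleNr scalerN opprK scalerA -cRM mulVf // scale1r.
  by apply: rspanZ; exact: (lincomb_rspan l (fun i => v i.+1)).
move: v0; rewrite vz scale0r add0r => /(IH (fun i => v i.+1) lf) h [//|i]; exact: h.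
Qed.

(** A free family makes coordinates unique, which is what keeps the norm away from 0 on the unit
    sphere of coordinates. *)
Lemma rfree_extract l : exists l', [/\ {subset l' <= l}, rfree l' &
  forall x, rspan l x -> rspan l' x].
Proof.
elim: l => [|y l [l' [sl fl hl]]]; first by exists [::].
have [yl|yl] := pselect (rspan l' y).
  exists l'; split=> //; first by move=> z /sl zl; rewrite inE zl orbT.
  move=> x /= [a /hl xa]; rewrite -(subrK (a *r y) x).
  by apply: rspanD => //; exact: rspanZ.
exists (y :: l'); split=> // [z|x /= [a /hl xa]]; last by exists a.
by rewrite !inE => /orP[->//|/sl ->]; rewrite orbT.
Qed.

Lemma rV_coord_le n (v : 'rV[R]_n) i : `|v ord0 i| <= `|v|.
Proof.
have /mapP[j Hj ->] : `|v ord0 i| \in [seq `|v x.1 x.2| | x : 'I_1 * 'I_n].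
  by apply/mapP; exists (ord0, i) => //=; rewrite mem_enum.
by rewrite [leRHS]/Num.Def.normr /= mx_normrE; apply/bigmax_geP; right => /=; exists j.
Qed.

(** Comparison of norms by compactness: in coordinates p is at most |v| times the sum of the p(l_i),
    while nh has a positive minimum on the unit sphere; C is the quotient of the two. *)
Lemma seminorm_le_norm_on (S : set X) (nh p : X -> R) l :
  lin_subspace S -> norm_on S nh ->
  (forall x y, p (x + y) <= p x + p y) -> (forall a x, p (a *r x) = `|a| * p x) ->
  rfree l -> (forall y, y \in l -> S y) ->
  exists C, forall x, rspan l x -> p x <= C * nh x.
Proof.
move=> [S0 Slin] [nh0 [nh_eq0 [nhD nhZ]]] pD pZ lf lS.
have SD x y : S x -> S y -> S (x + y) by move=> Sx Sy; rewrite -[x]scale1r; exact: Slin.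
have SZ a x : S x -> S (a *r x) by move=> Sx; rewrite -[_ *: _]addr0; exact: Slin.
have nhZr a x : S x -> nh (a *r x) = `|a| * nh x by move=> /nhZ ->; rewrite Re_norm_cR.
have p0 : p 0 = 0 by rewrite -(scale0r (0 : X)) -cR0 pZ normr0 mul0r.
have nh00 : nh 0 = 0 by rewrite -(scale0r (0 : X)) -cR0 nhZr // normr0 mul0r.
pose n := size l.
have lSi (i : 'I_n) : S l`_i by apply/lS/mem_nth.
pose comb (v : 'rV[R]_n) := \sum_(i < n) v ord0 i *r l`_i.
have combS v : S (comb v).
  by rewrite /comb; elim/big_ind: _ => // i _; exact: SZ.
have combB v w : comb v - comb w = comb (v - w).
  by rewrite /comb -sumrB; apply: eq_bigr => i _; rewrite -scalerBl -cRB !mxE.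
have combZ a v : comb (a *: v) = a *r comb v.
  by rewrite /comb scaler_sumr; apply: eq_bigr => i _; rewrite mxE cRM scalerA.
have comb_eq0 v : comb v = 0 -> v = 0.
  pose w k := if insub k is Some i then v ord0 i else 0.
  move=> h; apply/rowP => i; rewrite mxE.
  have /(rfree_lincomb0 lf)/(_ i (ltn_ord i)) : \sum_(i < size l) w i *r l`_i = 0.
    by rewrite -[RHS]h; apply: eq_bigr => j _; rewrite /w valK.
  by rewrite /w valK.
have comb_le (q : X -> R) v : q 0 = 0 ->
    (forall x y, S x -> S y -> q (x + y) <= q x + q y) ->
    (forall a x, S x -> q (a *r x) = `|a| * q x) -> (forall i : 'I_n, 0 <= q l`_i) ->
    q (comb v) <= `|v| * \sum_(i < n) q l`_i.
  move=> q0 qD qZ qp; rewrite mulr_sumr.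
  have [_] : S (comb v) /\ q (comb v) <= \sum_(i < n) `|v| * q l`_i; last by [].
  rewrite /comb; apply: (big_ind2 (fun x b => S x /\ q x <= b)) => [|x a y b [Sx xa] [Sy yb]|i _].
  - by rewrite q0.
  - by split; [exact: SD|apply: le_trans (qD _ _ _ _) (lerD _ _)].
  - by split; [exact: SZ|rewrite qZ // ler_wpM2r // rV_coord_le].
have pge0 x : 0 <= p x.
  have := pD x (-1 *r x); rewrite pZ normrN1 mul1r cRN cR1 scaleN1r subrr p0; lra.
pose Sph := [set v : 'rV[R]_n | `|v| = 1].
have rspan_comb x : rspan l x -> exists v, x = comb v.
  move=> /rspan_lincomb[v ->]; exists (\row_i v i).
  by apply: eq_bigr => i _; rewrite mxE.
(* If the sphere is empty, every coordinate vector is 0 and the constant 0 will do. *)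
have [[v0 v00]|noS] := pselect (Sph !=set0); last first.
  exists 0 => x /rspan_comb[v ->]; have [->|vN] := eqVneq v 0.
    by rewrite -(scale0r (0 : 'rV_n)) combZ cR0 scale0r p0 mul0r.
  case: noS; exists (`|v|^-1 *: v); rewrite /Sph /= normrZ normfV normr_id mulVf //.
  by rewrite normr_eq0.
have cS : compact Sph.
  apply: bounded_closed_compact.
    by exists 1; split=> // M M1 v /= ->; exact: ltW.
  have -> : Sph = (fun v : 'rV[R]_n => `|v|) @^-1` [set 1] by [].
  apply: closed_comp; first by move=> v _; exact: norm_continuous.
  exact: closed_eq.
pose K := \sum_(i < n) nh l`_i.
have K0 : 0 <= K by apply: sumr_ge0 => i _; exact: nh0.
have nh_comb v : nh (comb v) <= `|v| * K.
  by apply: comb_le => // i; exact: nh0.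
have nhB x y : S x -> S y -> nh x <= nh y + nh (x - y).
  move=> Sx Sy; rewrite -{1}(subrK y x) addrC; apply: nhD => //.
  by rewrite addrC -scaleN1r; exact: Slin.
have cf : continuous (fun v => nh (comb v)).
  move=> v; apply/(@cvgrPdist_le _ _ _ (nbhs v) (nbhs_filter v)) => e e0; have K1 : 0 < K + 1 by lra.
  have near_v : \forall w \near v, `|v - w| <= e / (K + 1).
    by move: (e / (K + 1)) (divr_gt0 e0 K1); apply/(@cvgrPdist_le _ _ _ (nbhs v) (nbhs_filter v) id v).
  near=> w; have h : `|v - w| * K <= e.
    have vw : `|v - w| <= e / (K + 1).
      by near: w.
    apply: le_trans (_ : e / (K + 1) * (K + 1) <= _); last by rewrite divfK // gt_eqF.
    apply: ler_pM => //; lra.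
  rewrite ler_norml; apply/andP; split.
    rewrite lerBrDr addrC lerBlDr; apply: le_trans (nhB _ (comb v) _ _) _ => //.
    by rewrite lerD2l combB (le_trans (nh_comb _)) // distrC.
  rewrite lerBlDr addrC; apply: le_trans (nhB _ (comb w) _ _) _ => //.
  by rewrite lerD2l combB (le_trans (nh_comb _)).
have [v1] := @EVT_min_rV R n (fun v => nh (comb v)) Sph (ex_intro _ v0 v00) cS
  (continuous_subspaceT cf).
rewrite inE /= => v11 v1min.
have m0 : 0 < nh (comb v1).
  rewrite lt_neqAle nh0 // andbT eq_sym; apply/eqP => /(nh_eq0 _ (combS _))/comb_eq0 v1E.
  by move: v11; rewrite v1E /Sph /= normr0 => /esym/eqP; rewrite oner_eq0.
exists ((\sum_(i < n) p l`_i) / nh (comb v1)) => x /rspan_comb[v ->].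
have h1 : p (comb v) <= `|v| * \sum_(i < n) p l`_i by apply: comb_le.
have h2 : `|v| * nh (comb v1) <= nh (comb v).
  have [->|vN] := eqVneq v 0; first by rewrite normr0 mul0r nh0.
  have vp : 0 < `|v| by rewrite normr_gt0.
  have : nh (comb v1) <= nh (comb (`|v|^-1 *: v)).
    apply: v1min; rewrite inE /Sph /= normrZ normfV normr_id mulVf // gt_eqF //.
  by rewrite combZ nhZr // normfV normr_id ler_pdivlMl.
apply: le_trans h1 _; rewrite [leRHS]mulrAC ler_pdivlMr // mulrAC mulrC ler_wpM2l //.
by apply: sumr_ge0 => i _.
Unshelve. all: by end_near. Qed.

(** Continuity of p is an outcome here, so p may be the norm of an operator's value; this is how
    operators on a mesh are seen to be bounded. *)
Lemma fin_dim_seminorm_le (S : set X) (nh p : X -> R) :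
  fin_dim S -> norm_on S nh ->
  (forall x y, p (x + y) <= p x + p y) -> (forall a x, p (a *r x) = `|a| * p x) ->
  exists C, forall x, S x -> p x <= C * nh x.
Proof.
move=> [Slin [b Sb]] nhn pD pZ.
pose l := b ++ [seq (Complex 0 1) *: y | y <- b].
have bS y : y \in b -> S y.
  move=> yb; apply/Sb; exists (fun i => if (i : nat) == index y b then 1 else 0).
  rewrite -index_mem in yb; rewrite (bigD1 (Ordinal yb)) //= eqxx scale1r.
  rewrite nth_index -?index_mem // big1 ?addr0 // => i ib.
  case: eqP => [ii|]; last by rewrite scale0r.
  by case/eqP: ib; exact: val_inj.
have lS y : y \in l -> S y.
  rewrite mem_cat => /orP[/bS//|/mapP[z /bS zS ->]].
  by rewrite -[_ *: _]addr0; apply: Slin.2 => //; exact: Slin.1.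
have [l' [sl fl hl]] := rfree_extract l.
have [C CP] := seminorm_le_norm_on Slin nhn pD pZ fl (fun y yl => lS _ (sl _ yl)).
exists C => x /Sb[al ->]; apply/CP/hl.
elim/big_ind: _ => [|y z|i _]; [exact: rspan0|exact: rspanD|].
have -> : al i = cR (complex.Re (al i)) + cR (complex.Im (al i)) * (Complex 0 1).
  by case: (al i) => r im; apply/eqP; rewrite eq_complex /=; apply/andP; split; apply/eqP; ring.
rewrite scalerDl -scalerA; apply: rspanD; apply/rspanZ/rspan_mem; rewrite mem_cat.
  by rewrite mem_nth.
by apply/orP; right; apply/map_f/mem_nth.
Qed.

End RealSpan.

(** * Lagrange interpolation *)

Section Lagrange.
Variables (R : realType) (s : nat) (c : 'I_s -> R).
Hypothesis c_inj : injective c.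

Lemma size_lagr i : (size (lagr c i) <= s)%N.
Proof.
have s0 : (0 < s)%N by case: s i => // -[].
have cP : #|[pred m : 'I_s | m != i]| = s.-1.
  by rewrite -[in RHS](card_ord s) -(cardC1 i); apply: eq_card => m; rewrite !inE.
rewrite /lagr; apply: leq_trans (size_prod_leq _ _) _; rewrite cP.
have h : (\sum_(m < s | m != i) size (('X - (c m)%:P) * ((c i - c m)^-1)%:P)%R <= s.-1 * 2)%N.
  rewrite -cP -sum_nat_const; apply: leq_sum => m _.
  apply: leq_trans (size_polyMleq _ _) _; rewrite size_XsubC /=.
  by rewrite ltnS; exact: size_polyC_leq1.
rewrite leq_subLR; apply: leq_ltn_trans h _; rewrite muln2 -addnn -[X in (_ < _ + X)%N]prednK //.
by rewrite addnS ltnS.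
Qed.

Lemma lagr_node i j : (lagr c i).[c j] = (i == j)%:R.
Proof.
rewrite /lagr horner_prod; have [<-|ij] := eqVneq i j.
  rewrite big1 // => m mi; rewrite !hornerE divff // subr_eq0.
  by apply: contra mi => /eqP/c_inj ->.
apply/eqP; rewrite prodf_seq_eq0; apply/hasP; exists j; first by rewrite mem_index_enum.
by rewrite eq_sym ij !hornerE subrr mul0r eqxx.
Qed.

(** The difference of the two sides has degree less than s and s distinct roots. Interpolation is
    thus exact on Taylor polynomials of degree less than s. *)
Lemma lagr_reproduce q theta : (q < s)%N ->
  \sum_(i < s) (lagr c i).[theta] * c i ^+ q = theta ^+ q.
Proof.
move=> qs; pose P := \sum_(i < s) (c i ^+ q) *: lagr c i - 'X^q.
suff P0 : P = 0.
  have := congr1 (fun p : {poly R} => p.[theta]) P0.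
  rewrite /P !hornerE horner_sum => /subr0_eq <-.
  by apply: eq_bigr => i _; rewrite hornerZ mulrC.
apply: (@roots_geq_poly_eq0 _ _ [seq c i | i <- enum 'I_s]).
- apply/allP => _ /mapP[j _ ->]; rewrite /root /P !hornerE horner_sum.
  rewrite (bigD1 j) //= hornerZ lagr_node eqxx mulr1 big1 ?addr0 ?subrr //.
  by move=> i ij; rewrite hornerZ lagr_node (negPf ij) mulr0.
- by rewrite map_inj_uniq ?enum_uniq.
- rewrite size_map size_enum_ord; apply: leq_trans (size_polyD _ _) _.
  rewrite geq_max size_polyN size_polyXn qs andbT.
  apply: leq_trans (size_sum _ _ _) _; apply/bigmax_leqP => i _.
  exact: leq_trans (size_scale_leq _ _) (size_lagr i).
Qed.

(** The link between the weights of the scheme and the interpolant: the powers tau^j/j! are the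
    sources of the equations solved by the phi-terms. The index j here stands for j + 1 in
    a_{i,j}. *)
Lemma lagr_acoef i (k tau : R) : \sum_(j < s) acoef c i j * k ^- j * (tau ^+ j / j`!%:R) =
  (lagr c i).[tau / k].
Proof.
rewrite (horner_coef_wide _ (size_lagr i)); apply: eq_bigr => j _.
rewrite /acoef expr_div_n.
have f0 : j`!%:R != 0 :> R by rewrite pnatr_eq0 -lt0n fact_gt0.
by rewrite (mulrC (tau ^+ j) _^-1) mulrA (mulrAC _ (k ^- j)) mulfK // -mulrA (mulrC (k ^- j)).
Qed.

(** A bound for the Lebesgue constant on [0, 1], depending on the nodes alone. *)
Lemma lagr_bounded : exists2 K, 0 <= K & forall theta, 0 <= theta <= 1 ->
  \sum_(i < s) `|(lagr c i).[theta]| <= K.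
Proof.
exists (\sum_(i < s) \sum_(j < s) `|(lagr c i)`_j|).
  by apply: sumr_ge0 => i _; apply: sumr_ge0.
move=> th /andP[t0 t1]; apply: ler_sum => i _.
rewrite (horner_coef_wide _ (size_lagr i)); apply: le_trans (ler_norm_sum _ _ _) _.
apply: ler_sum => j _; rewrite normrM normrX (ger0_norm t0) ler_piMr //.
by rewrite exprn_ile1.
Qed.

End Lagrange.

(** * Taylor remainders and interpolation error of vector-valued functions *)

Section Interpolation.
Variables (R : realType) (X : completeNormedModType R[i]).
Implicit Types (a : nat -> X) (t T : R).

Lemma egf_trunc a n t : egf (fun m => if (m < n)%N then a m else 0) t = egf_sum a t n.
Proof.
apply: egf_unique; apply/cvg_nrmP => e e0; exists n => N nN.
rewrite /egf_sum (big_ord_widen N (fun m => cR (t ^+ m / m`!%:R) *: a m)) //.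
rewrite [X in _ - X]big_mkcond /= -sumrB big1 ?nrm0 ?ltW // => i _.
by case: ifP; rewrite ?scaler0 subrr.
Qed.

(** A polynomial is the [egf] of a finitely supported sequence, which is geometrically bounded with
    ratio 1, so [egf_taylor2] applies. *)
Lemma egf_sum_has_deriv a n L t : 0 <= t <= L ->
  has_deriv L (fun r => egf_sum a r n.+1) t (egf_sum (fun m => a m.+1) t n).
Proof.
move=> /andP[t0 tL].
pose b N m := if (m < N)%N then a m else 0.
have bg : geom_bounded (\sum_(m < n.+1) nrm (a m)) 1 (b n.+1).
  split=> // [|m]; first by apply: sumr_ge0 => i _; exact: nrm_ge0.
  rewrite expr1n mulr1 /b; case: ifP => [mn|_].
    by rewrite (bigD1 (Ordinal mn)) //= lerDl sumr_ge0 // => i _; exact: nrm_ge0.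
  by rewrite nrm0 sumr_ge0 // => i _; exact: nrm_ge0.
apply: quadratic_has_deriv => r /andP[r0 rL].
have := @egf_taylor2 _ _ _ _ (L + 1) _ r t bg.
rewrite !ger0_norm // /b !(egf_trunc a).
rewrite [egf _ t](egf_trunc (fun m => a m.+1) n t); apply; lra.
Qed.

Lemma continuous_segment_bounded T (g : R -> X) : 0 <= T ->
  {within `[0, T], continuous g} ->
  exists M, forall t, 0 <= t <= T -> nrm (g t) <= M.
Proof.
move=> T0 /subspace_continuousP gc; apply: locally_bounded_segment => // t tT.
have /gc/cvgrPdistC_le/(_ 1 ltr01) : `[0, T] t by rewrite /= in_itv.
rewrite near_withinE => /nbhs_ballP[d /= d0 dP]; exists d => //; exists (nrm (g t) + 1) => r rT rt.
have /dP : ball t d r by rewrite -ball_normE /= distrC.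
rewrite /= in_itv => /(_ rT); rewrite -cR_nrm -cR1 cR_le => h.
rewrite -(subrK (g t) (g r)) addrC; apply: le_trans (nrmD _ _) _.
by rewrite lerD2l.
Qed.

(** The remainder of order d + 1 of [G q] vanishes at t, and its derivative is the remainder of
    order d of [G q.+1]; each mean value inequality contributes a factor r. The sharp 1/d! is given
    away. *)
Lemma taylor_le T s (G : nat -> R -> X) M t : 
  (forall i, (i < s)%N -> deriv_on T (G i) (G i.+1)) ->
  (forall r, 0 <= r <= T -> nrm (G s r) <= M) ->
  forall d q, (q + d = s)%N -> forall r, 0 <= t -> 0 <= r -> t + r <= T ->
  nrm (G q (t + r) - egf_sum (fun i => G (q + i)%N t) r d) <= M * r ^+ d.
Proof.
move=> Gd GM d; elim: d => [|d IH] q qd r t0 r0 rT.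
  rewrite /egf_sum big_ord0 subr0 expr0 mulr1; rewrite addn0 in qd.
  by rewrite qd GM //; apply/andP; split; lra.
have M0 : 0 <= M by apply: le_trans (GM (t + r) _); [exact: nrm_ge0|apply/andP; split; lra].
have qs : (q < s)%N by rewrite -qd addnS ltnS leq_addr.
have := @mean_value_seminorm _ _ _
  (fun z => G q (t + z) - egf_sum (fun i => G (q + i)%N t) z d.+1)
  (fun z => G q.+1 (t + z) - egf_sum (fun i => G (q + i.+1)%N t) z d) r (M * r ^+ d)
  (nrm_bounded_seminorm X) r0.
rewrite -mulrA -exprSr addr0.
have -> : egf_sum (fun i => G (q + i)%N t) 0 d.+1 = G q t.
  rewrite /egf_sum big_ord_recl /= expr0 fact0 divr1 scale1r addn0 big1 ?addr0 //.
  by move=> i _; rewrite exprS !mul0r scale0r.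
rewrite subrr subr0; apply.
  move=> z /andP[z0 zr]; apply: has_derivB.
    apply: (@has_deriv_shift _ _ T) => //; apply: deriv_onP (Gd _ qs) _ _.
    by apply/andP; split; lra.
  by apply: (@egf_sum_has_deriv (fun i => G (q + i)%N t)); rewrite z0.
move=> z /andP[z0 zr].
have -> : egf_sum (fun i => G (q + i.+1)%N t) z d = egf_sum (fun i => G (q.+1 + i)%N t) z d.
  by congr (egf_sum _ z d); apply/funext => i; rewrite addnS addSn.
apply: le_trans (IH q.+1 _ z _ _ _) _ => //; [by rewrite addSn -addnS|lra|].
by rewrite ler_wpM2l // lerXn2r ?nnegrE.
Qed.

(** The Taylor polynomial P at t is reproduced, so the error equals (f - P) minus the interpolant of
    f - P. Both are controlled by the Taylor remainder, the second with the Lebesgue constant K,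
    whence M + K M. *)
Lemma interpolation_error T s (c : 'I_s -> R) (f : R -> X) : 0 < T ->
  injective c -> (forall i, 0 <= c i <= 1) -> Cs_on T s f ->
  exists2 C, 0 <= C & forall t k tau, 0 <= t -> 0 < k -> t + k <= T -> 0 <= tau <= k ->
    nrm (f (t + tau) - \sum_(i < s) (lagr c i).[tau / k] *r f (t + c i * k)) <= C * k ^+ s.
Proof.
move=> T0 ci c01 [G [<- [Gc Gd]]].
have [M0 GM0] := continuous_segment_bounded (ltW T0) (Gc s (leqnn s)).
pose M := Num.max 0 M0.
have M_ge0 : 0 <= M by rewrite le_max lexx.
have GM r : 0 <= r <= T -> nrm (G s r) <= M by move=> /GM0 h; rewrite le_max h orbT.
have [K K0 KP] := lagr_bounded c.
exists (M + K * M) => [|t k tau t0 k0 tk /andP[tau0 tauk]].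
  by rewrite addr_ge0 // mulr_ge0.
pose P r := egf_sum (fun i => G i t) r s.
have rem r : 0 <= r <= k -> nrm (G 0%N (t + r) - P r) <= M * k ^+ s.
  move=> /andP[r0 rk]; apply: le_trans (taylor_le Gd GM (add0n s) t0 r0 _) _; first lra.
  by rewrite ler_wpM2l // lerXn2r ?nnegrE // ltW.
have PE : P tau = \sum_(i < s) (lagr c i).[tau / k] *r P (c i * k).
  rewrite /P /egf_sum; under [RHS]eq_bigr do rewrite scaler_sumr.
  rewrite exchange_big /=; apply: eq_bigr => r _.
  under eq_bigr do rewrite scalerA -cRM.
  rewrite -scaler_suml; congr (_ *: _).
  have -> : \sum_(i < s) cR ((lagr c i).[tau / k] * ((c i * k) ^+ r / r`!%:R)) =
      cR (\sum_(i < s) ((lagr c i).[tau / k] * ((c i * k) ^+ r / r`!%:R))).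
    by elim/big_ind2: _ => // x1 x2 y1 y2 -> ->; rewrite cRD.
  congr (cR _); rewrite -{1}[tau](divfK (lt0r_neq0 k0)) exprMn.
  rewrite -(lagr_reproduce ci _ (ltn_ord r)) !mulr_suml; apply: eq_bigr => i _.
  by rewrite exprMn; ring.
have -> : G 0%N (t + tau) - \sum_(i < s) (lagr c i).[tau / k] *r G 0%N (t + c i * k) =
   (G 0%N (t + tau) - P tau) - \sum_(i < s) (lagr c i).[tau / k] *r (G 0%N (t + c i * k) - P (c i * k)).
  under [X in _ = _ - X]eq_bigr do rewrite scalerBr.
  by rewrite sumrB -PE subrBB subrr subr0.
apply: le_trans (nrmB _ _) _; rewrite mulrDl; apply: lerD; first by rewrite rem ?tau0.
apply: le_trans (nrm_sum _ _) _.
apply: le_trans (_ : \sum_(i < s) `|(lagr c i).[tau / k]| * (M * k ^+ s) <= _).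
  apply: ler_sum => i _; rewrite nrmZr ler_wpM2l // rem //.
  have /andP[c0 c1] := c01 i; rewrite (mulr_ge0 c0 (ltW k0)) /=.
  by rewrite ler_piMl // ltW.
rewrite -mulr_suml -mulrA ler_wpM2r //; first by rewrite mulr_ge0 // exprn_ge0 // ltW.
by apply: KP; rewrite divr_ge0 ?(ltW k0) //= ler_pdivrMr // mul1r.
Qed.

End Interpolation.

(** * The semidiscrete problem on a fixed mesh *)

Section DerivativeAlgebra.
Variables (R : realType) (X : normedModType R[i]).
Implicit Types (g : R -> X) (v : X) (L t a : R).

Lemma has_derivZ L g t v a : has_deriv L g t v ->
  has_deriv L (fun r => a *r g r) t (a *r v).
Proof.
apply: (@linear_on_has_deriv _ _ _ (fun x => a *r x) _ `|a|) => [b x y _ _|x].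
  by rewrite scalerDr !scalerA mulrC.
by rewrite nrmZr.
Qed.

Lemma has_derivD L g1 g2 t v1 v2 : has_deriv L g1 t v1 -> has_deriv L g2 t v2 ->
  has_deriv L (fun r => g1 r + g2 r) t (v1 + v2).
Proof.
move=> d1 /(@has_derivZ _ _ _ _ (-1)) /(has_derivB d1).
rewrite cRN cR1 scaleN1r opprK.
by under [X in has_deriv _ X]eq_fun do rewrite scaleN1r opprK.
Qed.

Lemma has_deriv_sum I (r : seq I) (g : I -> R -> X) (v : I -> X) L t :
  (forall i, has_deriv L (g i) t (v i)) ->
  has_deriv L (fun z => \sum_(i <- r) g i z) t (\sum_(i <- r) v i).
Proof.
move=> d; elim: r => [|i r IH].
  rewrite big_nil; under [X in has_deriv _ X]eq_fun do rewrite big_nil.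
  by move=> e e0; exists 1 => // z _ _; rewrite !subrr scaler0 subrr nrm0 mulr_ge0 // ltW.
rewrite big_cons; under [X in has_deriv _ X]eq_fun do rewrite big_cons.
exact: has_derivD.
Qed.

End DerivativeAlgebra.

Section Subspace.
Variables (R : realType) (X : normedModType R[i]) (S : set X).
Hypothesis Ssub : lin_subspace S.

Lemma subspaceD x y : S x -> S y -> S (x + y).
Proof. by move=> Sx Sy; rewrite -[x]scale1r; exact: Ssub.2. Qed.

Lemma subspaceZ (a : R[i]) x : S x -> S (a *: x).
Proof. by move=> Sx; rewrite -[_ *: _]addr0; apply: Ssub.2 => //; exact: Ssub.1. Qed.

Lemma subspaceB x y : S x -> S y -> S (x - y).
Proof. by move=> Sx Sy; rewrite -scaleN1r; apply: subspaceD => //; exact: subspaceZ. Qed.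

Lemma subspace_sum I (r : seq I) (F : I -> X) : (forall i, S (F i)) -> S (\sum_(i <- r) F i).
Proof. by move=> SF; elim/big_ind: _ => //; [exact: Ssub.1|exact: subspaceD]. Qed.

End Subspace.

Section Mesh.
Variables (R : realType) (X : completeNormedModType R[i]).
Variables (S' S0 : set X) (n : X -> R) (A0 L : X -> X) (CB : R).
Hypotheses (S'fin : fin_dim S') (S0sub : lin_subspace S0) (S0S' : S0 `<=` S').
Hypothesis n_norm : norm_on S' n.
Hypotheses (A0lin : linear_on S0 A0) (A0map : forall x, S0 x -> S0 (A0 x)).
Hypotheses (Llin : linear_on setT L) (Lmap : forall x, S0 (L x)).
Hypothesis Lproj : forall x, S0 x -> L x = x.
Hypothesis CB0 : 0 <= CB.
Hypothesis exp_le : forall t x, 0 <= t -> S0 x -> n (opexp A0 t x) <= CB * n x.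
Hypothesis L_le : forall x, n (L x) <= CB * nrm x.

(* Precomposition with the projection extends A_{h,0} and |.|_h to all of X. *)
Definition mesh_op x := A0 (L x).
Definition mesh_seminorm x := n (L x).
Local Notation B := mesh_op.
Local Notation p := mesh_seminorm.

Lemma mesh_seminormE x : S0 x -> p x = n x.
Proof. by move=> /Lproj xE; rewrite /mesh_seminorm xE. Qed.

Lemma mesh_opE x : S0 x -> B x = A0 x.
Proof. by move=> /Lproj xE; rewrite /mesh_op xE. Qed.

Lemma A0B x y : S0 x -> S0 y -> A0 (x - y) = A0 x - A0 y.
Proof.
move=> Sx Sy; rewrite -[in LHS]scaleN1r addrC A0lin //.
by rewrite scaleN1r addrC.
Qed.

Lemma mesh_op_linear : linear_on setT B.
Proof. by move=> a x y _ _; rewrite /mesh_op Llin // A0lin. Qed.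

Lemma mesh_seminorm_bounded : bounded_seminorm p.
Proof.
have [_ [_ [nD nZ]]] := n_norm; split.
- by move=> x y; rewrite /mesh_seminorm (linear_onD Llin); apply: nD; exact: S0S'.
- move=> a x; rewrite /mesh_seminorm (linear_onZ Llin) nZ ?Re_norm_cR //; exact: S0S'.
- by exists CB.
Qed.

Lemma on_mesh_bounded (q : X -> R) :
  (forall x y, q (x + y) <= q x + q y) -> (forall a x, q (a *r x) = `|a| * q x) ->
  exists K, forall x, q (L x) <= K * nrm x.
Proof.
move=> qD qZ; have [C CP] := fin_dim_seminorm_le S'fin n_norm qD qZ.
exists (`|C| * CB) => x; apply: le_trans (CP _ (S0S' (Lmap x))) _.
have n0 : 0 <= n (L x) by apply: (n_norm.1); exact: S0S'.
rewrite -mulrA; apply: le_trans (ler_wpM2r n0 (ler_norm C)) _.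
by rewrite ler_wpM2l.
Qed.

Lemma L_nrm_bounded : exists K, forall x, nrm (L x) <= K * nrm x.
Proof. by apply: on_mesh_bounded; [exact: nrmD|exact: nrmZr]. Qed.

(** [beta] depends on the mesh and serves only convergence and differentiability. Being at least 1,
    its powers increase, which gives one geometric bound for the shifted coefficients of every
    [epow j]. *)
Lemma mesh_op_bounded : exists2 beta, 1 <= beta & forall x, nrm (B x) <= beta * nrm x.
Proof.
have [|a x|K KP] := @on_mesh_bounded (fun x => nrm (B x)).
- by move=> x y; rewrite (linear_onD mesh_op_linear) nrmD.
- by rewrite (linear_onZ mesh_op_linear) nrmZr.
exists (`|K| + 1); first by rewrite lerDr.
move=> x; have := KP x; rewrite {1}/mesh_op (Lproj (Lmap x)).
move=> /le_trans; apply; rewrite ler_wpM2r ?nrm_ge0 // (le_trans (ler_norm K)) // lerDl //.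
Qed.

Lemma iter_mesh_op m x : S0 x -> iter m B x = iter m A0 x /\ S0 (iter m A0 x).
Proof.
move=> Sx; elim: m => [//|m [IH IHS]]; rewrite !iterS IH mesh_opE //.
by split=> //; exact: A0map.
Qed.

Lemma opexp_mesh t x : S0 x -> opexp A0 t x = epow B 0 t x.
Proof.
move=> Sx; rewrite -opexpE /opexp; congr (lim (_ @ \oo)); apply/funext => N.
by apply: eq_bigr => i _; rewrite (iter_mesh_op i Sx).1.
Qed.

Lemma phi_mesh j k x : 0 < k -> S0 x -> phi j.+1 A0 k x = phi j.+1 B k x.
Proof.
move=> k0 Sx; rewrite /phi; congr (_ *: rint _ _); apply/funext => tau.
by rewrite opexp_mesh // opexpE.
Qed.

Variable beta : R.
Hypotheses (beta1 : 1 <= beta) (B_le : forall x, nrm (B x) <= beta * nrm x).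
Let Blin := mesh_op_linear.
Local Notation E := (epow B).
Let E_linear j t : linear_on setT (E j t) := epow_linear Blin beta1 B_le j t.

(** Instead of closedness of [S0]: L is bounded and fixes every coefficient of the series, hence
    fixes the sum, which therefore lies in the range of L. *)
Lemma epow_mesh j t x : S0 x -> S0 (E j t x).
Proof.
move=> Sx; suff <- : L (E j t x) = E j t x by [].
have [K KP] := L_nrm_bounded.
rewrite (egf_map t Llin KP (epow_coef_geom beta1 B_le j x)); congr (egf _ t).
apply/funext => m; apply: Lproj; rewrite /epow_coef; case: ifP => _.
  exact: S0sub.1.
by have [-> ] := iter_mesh_op (m - j) Sx.
Qed.

Lemma epow_mesh_le t x : 0 <= t -> S0 x -> p (E 0 t x) <= CB * n x.
Proof.
move=> t0 Sx; rewrite mesh_seminormE; last exact: epow_mesh.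
by rewrite -opexp_mesh //; exact: exp_le.
Qed.

Lemma epow_has_deriv T j t y : 0 <= t <= T ->
  has_deriv T (fun r => E j.+1 r y) t (E j t y).
Proof.
move=> /andP[t0 tT]; apply: quadratic_has_deriv => r /andP[r0 rT].
rewrite mulrC; have := @epow_taylor2 _ _ B beta beta1 B_le j r t (T + 1) y.
rewrite mulrAC mulrC; apply; rewrite ?ger0_norm //; lra.
Qed.

Variables (s : nat) (c : 'I_s -> R) (T : R) (f : R -> X) (U : R -> X).
Hypothesis c_inj : injective c.
Hypotheses (U_mesh : forall t, 0 <= t <= T -> S0 (U t))
  (U_deriv : deriv_on T U (fun t => A0 (U t) + L (f t))).

(** k is frozen in the weights while tau runs through the step. [quad_sum 1 k t] leads from 0 at tau
    = 0 to the correction of the scheme at tau = k, and [quad_sum 0 k t] is its derivative. The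
    weight k^{-j} is k times the k^{-(j+1)} of phi_{j+1}. *)
Definition quad_sum (j0 : nat) (k t tau : R) : X :=
  \sum_(i < s) \sum_(j < s) (acoef c i j * k ^- j) *r E (j0 + j) tau (L (f (t + c i * k))).

Lemma eq_stepE k t V : 0 < k -> S0 V ->
  eq_step c A0 L f k t V = E 0 k V + quad_sum 1 k t k.
Proof.
move=> k0 SV; rewrite /eq_step opexp_mesh //; congr (_ + _).
rewrite scaler_sumr; apply: eq_bigr => i _; rewrite scaler_sumr; apply: eq_bigr => j _.
rewrite phi_mesh // (phi_epow Blin beta1 B_le) // !scalerA -!cRM; congr (cR _ *: _).
by rewrite exprS; field; rewrite ?expf_neq0 ?lt0r_neq0.
Qed.

Lemma quad_sum_mesh j0 k t tau : S0 (quad_sum j0 k t tau).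
Proof.
apply: subspace_sum => // i; apply: subspace_sum => // j.
by apply: subspaceZ => //; exact: epow_mesh.
Qed.

Lemma eq_step_mesh k t V : 0 < k -> S0 V -> S0 (eq_step c A0 L f k t V).
Proof.
move=> k0 SV; rewrite eq_stepE //; apply: subspaceD => //; first exact: epow_mesh.
exact: quad_sum_mesh.
Qed.

Lemma quad_sum_deriv T' k t tau : 0 <= tau <= T' ->
  has_deriv T' (quad_sum 1 k t) tau (quad_sum 0 k t tau).
Proof.
move=> tauT; apply: has_deriv_sum => i; apply: has_deriv_sum => j.
by apply: has_derivZ; exact: epow_has_deriv.
Qed.

Lemma quad_sum_residual k t tau : quad_sum 0 k t tau - B (quad_sum 1 k t tau) =
  L (\sum_(i < s) (lagr c i).[tau / k] *r f (t + c i * k)).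
Proof.
rewrite /quad_sum (linear_on_sum Blin) (linear_on_sum Llin) -sumrB; apply: eq_bigr => i _.
rewrite (linear_on_sum Blin) (linear_onZ Llin) -sumrB -lagr_acoef.
have -> : cR (\sum_(j < s) acoef c i j * k ^- j * (tau ^+ j / j`!%:R)) =
    \sum_(j < s) cR (acoef c i j * k ^- j * (tau ^+ j / j`!%:R)).
  by elim/big_ind2: _ => // x1 x2 y1 y2 <- <-; rewrite cRD.
rewrite scaler_suml; apply: eq_bigr => j _.
rewrite (linear_onZ Blin) -scalerBr (epow_rec Blin beta1 B_le j) addrK.
by rewrite scalerA -cRM.
Qed.

Lemma local_error_le K k t : 0 <= t -> 0 < k -> t + k <= T ->
  (forall tau, 0 <= tau <= k ->
    nrm (f (t + tau) - \sum_(i < s) (lagr c i).[tau / k] *r f (t + c i * k)) <= K) ->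
  n (U (t + k) - eq_step c A0 L f k t (U t)) <= CB * (CB * K) * k.
Proof.
move=> t0 k0 tk fK.
have St : S0 (U t) by apply: U_mesh; apply/andP; split; lra.
have Stk : S0 (U (t + k)) by apply: U_mesh; apply/andP; split; lra.
rewrite -mesh_seminormE; last by apply: subspaceB => //; exact: eq_step_mesh.
rewrite eq_stepE // addrC opprD -addrA addrC -[_ + U _]addrC.
(* The correction vanishes at tau = 0, so this function starts at [U t] and Duhamel bounds exactly
   the local error. One factor [CB] is the stability of the exponential, the other the bound of
   L. *)
have := @duhamel_le _ _ B beta Blin beta1 B_le p
  (fun tau => U (t + tau) - quad_sum 1 k t tau)
  (fun tau => (A0 (U (t + tau)) + L (f (t + tau))) - quad_sum 0 k t tau)
  k (CB * (CB * K)) mesh_seminorm_bounded (ltW k0).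
have -> : quad_sum 1 k t 0 = 0.
  by apply: big1 => i _; apply: big1 => j _; rewrite epowS0 scaler0.
rewrite addr0 subr0; apply.
  move=> tau /andP[tau0 tauk]; apply: has_derivB; last by apply: quad_sum_deriv; rewrite tau0.
  apply: (@has_deriv_shift _ _ T) => //; apply: (deriv_onP U_deriv).
  by apply/andP; split; lra.
move=> tau /andP[tau0 tauk].
have Stt : S0 (U (t + tau)) by apply: U_mesh; apply/andP; split; lra.
rewrite (linear_onB Blin) (mesh_opE Stt).
have -> : A0 (U (t + tau)) + L (f (t + tau)) - quad_sum 0 k t tau -
    (A0 (U (t + tau)) - B (quad_sum 1 k t tau)) =
  L (f (t + tau) - \sum_(i < s) (lagr c i).[tau / k] *r f (t + c i * k)).
  by rewrite subrBB (addrAC (A0 _)) subrr add0r (linear_onB Llin) quad_sum_residual.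
apply: le_trans (epow_mesh_le _ (Lmap _)) _; first lra.
rewrite ler_wpM2l //; apply: le_trans (L_le _) _; rewrite ler_wpM2l //.
by apply: fK; rewrite tau0.
Qed.

Lemma eq_scheme_mesh k U0 N : 0 < k -> S0 U0 -> S0 (eq_scheme c A0 L f k U0 N).
Proof. by move=> k0 SU; elim: N => [//|N IH] /=; exact: eq_step_mesh. Qed.

(** The induction bounds [E 0 r] applied to the error for every r >= 0. Estimating [E 0 k] at each
    step would yield CB^N; with r free, the semigroup law turns r into r + k and each local error
    meets one exponential only. *)
Lemma global_error_le D k N : 0 < k -> N%:R * k <= T ->
  (forall N, N.+1%:R * k <= T ->
    n (U (N.+1%:R * k) - eq_step c A0 L f k (N%:R * k) (U (N%:R * k))) <= D) ->
  n (U (N%:R * k) - eq_scheme c A0 L f k (U 0) N) <= N%:R * (CB * D).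
Proof.
move=> k0 NT loc.
have SU M : M%:R * k <= T -> S0 (U (M%:R * k)).
  by move=> MT; apply: U_mesh; rewrite MT andbT mulr_ge0 // ltW.
have T0 : 0 <= T by apply: le_trans NT; rewrite mulr_ge0 // ltW.
have S00 : S0 (U 0) by apply: U_mesh; rewrite lexx.
have SV M := eq_scheme_mesh M k0 S00.
suff H : forall r, 0 <= r ->
    p (E 0 r (U (N%:R * k) - eq_scheme c A0 L f k (U 0) N)) <= N%:R * (CB * D).
  have := H 0 (lexx 0); rewrite epow0 mesh_seminormE //.
  exact: (subspaceB S0sub (SU _ NT) (SV _)).
elim: N NT => [|N IH] NT r r0.
  rewrite mul0r subrr (linear_on0 (E_linear _ _)) mul0r /mesh_seminorm (linear_on0 Llin).
  by rewrite -(linear_on0 Llin); have := L_le 0; rewrite nrm0 mulr0.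
have NT' : N%:R * k <= T by apply: le_trans NT; rewrite ler_wpM2r ?ltW // ltr_nat.
set V := eq_scheme c A0 L f k (U 0) N in IH *.
have -> : U (N.+1%:R * k) - eq_scheme c A0 L f k (U 0) N.+1 =
  (U (N.+1%:R * k) - eq_step c A0 L f k (N%:R * k) (U (N%:R * k))) +
  E 0 k (U (N%:R * k) - V).
  rewrite /= -/V (eq_stepE _ k0 (SU N NT')) (eq_stepE _ k0 (SV N)).
  rewrite (linear_onB (E_linear _ _)) -[RHS]addrA; congr (_ + _).
  by rewrite !opprD (addrC (- E 0 k (U _))) -addrA addKr addrC.
rewrite (linear_onD (E_linear _ _)) -(epow_semigroup Blin beta1 B_le) //; last exact: ltW.
have [pD _ _] := mesh_seminorm_bounded.
apply: le_trans (pD _ _) _.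
have -> : N.+1%:R * (CB * D) = CB * D + N%:R * (CB * D) by rewrite -natr1; ring.
apply: lerD; last by apply: IH => //; rewrite addr_ge0 // ltW.
apply: le_trans (epow_mesh_le r0 _) _.
  by apply: (subspaceB S0sub (SU _ NT)); apply: eq_step_mesh => //; exact: SU.
by rewrite ler_wpM2l // loc.
Qed.

(** Stability under a defect r: v and U start together and the residual of v - U is r. The intended
    v is L_h u. *)
Lemma semidiscrete_error_le (v v' r : R -> X) K t : 0 <= t <= T ->
  v 0 = U 0 -> (forall z, 0 <= z <= T -> has_deriv T v z (v' z)) ->
  (forall z, 0 <= z <= T -> S0 (v z)) ->
  (forall z, 0 <= z <= T -> v' z = A0 (v z) + L (f z) + r z) ->
  (forall z, 0 <= z <= T -> S0 (r z) /\ n (r z) <= K) ->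
  n (v t - U t) <= CB * K * t.
Proof.
move=> /andP[t0 tT] v0 dv Sv vE rK.
rewrite -mesh_seminormE; last by apply: subspaceB; [|apply: Sv|apply: U_mesh]; rewrite ?t0.
have := @duhamel_le _ _ B beta Blin beta1 B_le p (fun z => v z - U z)
  (fun z => v' z - (A0 (U z) + L (f z))) t (CB * K) mesh_seminorm_bounded t0.
rewrite v0 subrr (linear_on0 (E_linear _ _)) subr0; apply.
  move=> z /andP[z0 zt]; have zT : 0 <= z <= T by apply/andP; split; lra.
  exact: has_derivB (has_deriv_restrict tT (dv z zT))
    (has_deriv_restrict tT (deriv_onP U_deriv zT)).
move=> z /andP[z0 zt]; have zT : 0 <= z <= T by apply/andP; split; lra.
have [Sr rzK] := rK z zT.
rewrite (linear_onB Blin) !mesh_opE; [|exact: U_mesh|exact: Sv].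
have -> : v' z - (A0 (U z) + L (f z)) - (A0 (v z) - A0 (U z)) = r z.
  rewrite vE // subrBB -(addrA (A0 _)) (addrC (A0 (v z))) addrK.
  by rewrite (addrC (A0 (U z))) addrK [LHS]addrC addKr.
apply: le_trans (epow_mesh_le _ Sr) _; first lra.
by rewrite ler_wpM2l.
Qed.

End Mesh.

(** * Uniform constants and the three error estimates *)

Unset Implicit Arguments.

Theorem theorem1
  (R : realType) (X Y : completeNormedModType R[i])
  (* the operators A : D(A) -> X and partial : D(A) -> Y *)
  (DA : set X) (A : X -> X) (dA : X -> Y)
  (HDA : lin_subspace DA) (HDAdense : dense DA)
  (HAlin : linear_on DA A) (Hdlin : linear_on DA dA)
  (* (A1) *)
  (HA1 : forall v : Y, exists2 x, DA x & dA x = v)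
  (* (A2) *)
  (omega M : R) (Homega : omega < 0) (S : R -> X -> X)
  (HA2dense : dense [set x | DA x /\ dA x = 0])
  (HA2 : C0_semigroup_generated_by S M omega [set x | DA x /\ dA x = 0] A)
  (* (A3) *)
  (HA3 : forall z : R[i], omega < complex.Re z -> forall v : Y,
           exists! x, DA x /\ A x = z *: x /\ dA x = v)
  (HA3bd : exists omega0 L, omega < omega0 /\
           forall z : R[i], omega0 < complex.Re z -> forall (v : Y) (x : X),
           DA x -> A x = z *: x -> dA x = v -> nrm x <= L * nrm v)
  (* space discretization, indexed by m : nat, with parameters h = hs m -> 0 *)
  (hs : nat -> R) (Hhs_pos : forall m, 0 < hs m) (Hhs_lim : hs @ \oo --> 0)
  (Xh Xh0 : nat -> set X) (nh : nat -> X -> R)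
  (HXh : forall m, fin_dim (Xh m)) (HXh0 : forall m, lin_subspace (Xh0 m))
  (HXh0sub : forall m, Xh0 m `<=` Xh m)
  (Hnh : forall m, norm_on (Xh m) (nh m))
  (Ah0 Ah Lh : nat -> X -> X) (Qh : nat -> Y -> X) (Rh : nat -> X -> X)
  (HAh0lin : forall m, linear_on (Xh0 m) (Ah0 m))
  (HAh0map : forall m x, Xh0 m x -> Xh0 m (Ah0 m x))
  (HAhlin : forall m, linear_on (Xh m) (Ah m))
  (HAhmap : forall m x, Xh m x -> Xh0 m (Ah m x))
  (HLhlin : forall m, linear_on setT (Lh m))
  (HLhmap : forall m x, Xh0 m (Lh m x))
  (HLhproj : forall m x, Xh0 m x -> Lh m x = x)
  (HQhlin : forall m, linear_on setT (Qh m))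
  (HQhmap : forall m g, Xh m (Qh m g))
  (* elliptic projection *)
  (HRh : forall m w, DA w ->
     Xh0 m (Rh m w) /\ Ah0 m (Rh m w) + Ah m (Qh m (dA w)) = Lh m (A w))
  (* the space Z and the bound with epsilon_h *)
  (Z : set X) (nZ : X -> R) (HZ : lin_subspace Z) (HnZ : norm_on Z nZ)
  (HZDA : Z `<=` DA)
  (eps : nat -> R) (Heps_pos : forall m, 0 <= eps m)
  (Heps_mono : forall m m', hs m <= hs m' -> eps m <= eps m')
  (Heps : forall m u, Z u ->
     nh m (Ah0 m (Rh m u - Ph (Lh m) (Qh m) dA u)) <= eps m * nZ u)
  (* uniform (in h) bounds *)
  (Hunif : exists CB, 
     (forall m t x, 0 <= t -> Xh0 m x -> nh m (opexp (Ah0 m) t x) <= CB * nh m x) /\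
     (forall m x, nh m (Lh m x) <= CB * nrm x) /\
     (forall m g, nh m (Lh m (Qh m g)) <= CB * nrm g) /\
     (forall m x, DA x -> nh m (Ph (Lh m) (Qh m) dA x) <= CB * (nrm x + nrm (dA x))))
  (* the problem u' = A u + f, u(0) = u0, partial u = 0 *)
  (T : R) (HT : 0 < T) (u0 : X) (f u : R -> X)
  (Hu_sol : u 0 = u0 /\ (forall t, 0 <= t <= T -> DA (u t) /\ dA (u t) = 0) /\
            deriv_on T u (fun t => A (u t) + f t))
  (HuZ : C_on_Z T Z nZ u)
  (* the nodes *)
  (s : nat) (Hs : (0 < s)%N) (c : 'I_s -> R) (Hcinj : injective c)
  (Hc01 : forall i, 0 <= c i <= 1)
  (Hf : Cs_on T s f)
  (* the semidiscrete solution U_h *)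
  (Uh : nat -> R -> X)
  (HUh : forall m, Uh m 0 = Lh m (u 0) /\
     (forall t, 0 <= t <= T -> Xh0 m (Uh m t)) /\
     deriv_on T (Uh m) (fun t => Ah0 m (Uh m t) + Lh m (f t))) :
  (* (i) local error rho_{h,n} = O(k^{s+1}) *)
  (exists C, forall m (k : R), 0 < k -> forall n : nat, (n.+1)%:R * k <= T ->
     nh m (Uh m ((n.+1)%:R * k)
           - eq_step c (Ah0 m) (Lh m) f k (n%:R * k) (Uh m (n%:R * k)))
       <= C * k ^+ s.+1) /\
  (* (ii) e_{h,n} = O(k^s) *)
  (exists C, forall m (k : R), 0 < k -> forall n : nat, n%:R * k <= T ->
     nh m (Uh m (n%:R * k) - eq_scheme c (Ah0 m) (Lh m) f k (Lh m (u 0)) n)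
       <= C * k ^+ s) /\
  (* (iii) L_h u(t_n) - U_h^n = O(k^s + eps_h) *)
  (exists C, forall m (k : R), 0 < k -> forall n : nat, n%:R * k <= T ->
     nh m (Lh m (u (n%:R * k)) - eq_scheme c (Ah0 m) (Lh m) f k (Lh m (u 0)) n)
       <= C * (k ^+ s + eps m)).
Proof.
(* The sign of the given bound is unknown; its absolute value is used so that products of
   inequalities are legitimate. *)
have [CB [CB0 [exp_le [Lh_le _]]]] : exists CB, 0 <= CB /\
    (forall m t x, 0 <= t -> Xh0 m x -> nh m (opexp (Ah0 m) t x) <= CB * nh m x) /\
    (forall m x, nh m (Lh m x) <= CB * nrm x) /\ True.
  have [CB [h1 [h2 _]]] := Hunif; exists `|CB|; split=> //; split=> [m t x t0 Sx|].
    have n0 : 0 <= nh m x by apply: (Hnh m).1; exact: HXh0sub.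
    by apply: le_trans (h1 m t x t0 Sx) _; rewrite ler_wpM2r // ler_norm.
  split=> // m x; apply: le_trans (h2 m x) _; rewrite ler_wpM2r ?nrm_ge0 // ler_norm //.
have [C C0 CP] := interpolation_error HT Hcinj Hc01 Hf.
have op_bounded m := mesh_op_bounded (HXh m) (HXh0sub m) (Hnh m) (HAh0lin m)
  (HLhlin m) (HLhmap m) (HLhproj m) (Lh_le m).
have Uh_mesh m : forall t, 0 <= t <= T -> Xh0 m (Uh m t) by have [_ []] := HUh m.
have Uh_deriv m : deriv_on T (Uh m) (fun t => Ah0 m (Uh m t) + Lh m (f t)).
  by have [_ []] := HUh m.
have Uh0 m : Uh m 0 = Lh m (u 0) by have [] := HUh m.
pose D := CB * (CB * C).
have D0 : 0 <= D by rewrite /D !mulr_ge0.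
have loc m k n : 0 < k -> n.+1%:R * k <= T ->
    nh m (Uh m (n.+1%:R * k) - eq_step c (Ah0 m) (Lh m) f k (n%:R * k) (Uh m (n%:R * k)))
    <= D * k ^+ s.+1.
  move=> k0 nT; have [beta beta1 B_le] := op_bounded m.
  have nE : n.+1%:R * k = n%:R * k + k by rewrite -natr1 mulrDl mul1r.
  rewrite nE; rewrite nE in nT.
  have -> : D * k ^+ s.+1 = CB * (CB * (C * k ^+ s)) * k by rewrite /D exprS; ring.
  apply: (local_error_le (HXh m) (HXh0 m) (HXh0sub m) (Hnh m) (HAh0lin m)
    (HAh0map m) (HLhlin m) (HLhmap m) (HLhproj m) CB0 (exp_le m) (Lh_le m) beta1 B_le
    (Uh_mesh m) (Uh_deriv m)) => // [|tau tauk]; first by rewrite mulr_ge0 // ltW.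
  by apply: CP => //; rewrite mulr_ge0 // ltW.
have glob m k n : 0 < k -> n%:R * k <= T ->
    nh m (Uh m (n%:R * k) - eq_scheme c (Ah0 m) (Lh m) f k (Lh m (u 0)) n)
    <= CB * D * T * k ^+ s.
  move=> k0 nT; have [beta beta1 B_le] := op_bounded m.
  rewrite -Uh0; apply: le_trans (global_error_le (HXh m) (HXh0 m) (HXh0sub m) (Hnh m)
    (HAh0lin m) (HAh0map m) (HLhlin m) (HLhmap m) (HLhproj m) CB0 (exp_le m) (Lh_le m)
    beta1 B_le (Uh_mesh m) k0 nT (fun N => loc m k N k0)) _.
  (* One power of k is traded for the elapsed time nk <= T. *)
  have -> : n%:R * (CB * (D * k ^+ s.+1)) = CB * D * (n%:R * k) * k ^+ s.
    by rewrite exprS; ring.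
  apply: ler_wpM2r; first exact: exprn_ge0 (ltW k0).
  by apply: ler_wpM2l => //; exact: mulr_ge0.
split; first by exists D => m k k0 n; exact: loc.
split; first by exists (CB * D * T) => m k k0 n; exact: glob.
have [uZ u_cont] := HuZ; have [_ [uD u_deriv]] := Hu_sol.
(* Continuity into Z on a compact interval bounds the Z-norm of u, so the elliptic defect is a
   multiple of [eps m] uniformly in time. *)
have [MZ0 MZ0P] : exists M, forall t, 0 <= t <= T -> nZ (u t) <= M.
  apply: locally_bounded_segment; first exact: ltW.
  move=> t tT; have [d d0 dP] := u_cont t tT 1 ltr01.
  exists d => //; exists (1 + nZ (u t)) => r rT rt.
  have [_ [_ [nZD _]]] := HnZ.
  rewrite -{1}(subrK (u t) (u r)); apply: le_trans (nZD _ _ (subspaceB HZ (uZ r rT) (uZ t tT)) (uZ t tT)) _.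
  by rewrite lerD2r ltW // dP.
pose MZ := Num.max 0 MZ0.
have MZ_ge0 : 0 <= MZ by rewrite le_max lexx.
have space m t : 0 <= t <= T -> nh m (Lh m (u t) - Uh m t) <= CB * MZ * T * eps m.
  move=> tT; have [beta beta1 B_le] := op_bounded m.
  have [KL KLP] := L_nrm_bounded (HXh m) (HXh0sub m) (Hnh m) (HLhmap m) (Lh_le m).
  have PhE z : 0 <= z <= T -> Ph (Lh m) (Qh m) dA (u z) = Lh m (u z).
    move=> /uD[_ dA0]; rewrite /Ph dA0 (linear_on0 (HQhlin m)) (linear_on0 (HLhlin m)).
    exact: subr0.
  have res_mesh z : 0 <= z <= T -> Xh0 m (Rh m (u z) - Lh m (u z)).
    by move=> /uD[/(HRh m)[Rhu _] _]; exact: (subspaceB (HXh0 m) Rhu (HLhmap m _)).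
  apply: le_trans (semidiscrete_error_le (HXh m) (HXh0 m) (HXh0sub m) (Hnh m) (HAh0lin m)
    (HAh0map m) (HLhlin m) (HLhmap m) (HLhproj m) CB0 (exp_le m) (Lh_le m)
    beta1 B_le (Uh_mesh m) (Uh_deriv m) (v := fun z => Lh m (u z))
    (v' := fun z => Lh m (A (u z) + f z))
    (r := fun z => Ah0 m (Rh m (u z) - Ph (Lh m) (Qh m) dA (u z)))
    (K := eps m * MZ) tT _ _ _ _ _) _ => /=.
  - by rewrite Uh0.
  - move=> z zT; apply: (linear_on_has_deriv (HLhlin m) KLP).
    exact: deriv_onP u_deriv z zT.
  - by move=> z _; exact: HLhmap.
  (* With zero boundary value, P_h u = L_h u and the elliptic projection gives L_h A u = A_{h,0} R_h
     u; subtracting A_{h,0} L_h u leaves the defect A_{h,0}(R_h - P_h)u. *)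
  - move=> z zT; have [DAu dAu] := uD z zT; have [Rhu RhE] := HRh m _ DAu.
    rewrite PhE // (A0B (HAh0lin m)) //.
    rewrite (linear_onD (HLhlin m)) -RhE dAu (linear_on0 (HQhlin m)).
    have -> : Ah m 0 = 0.
      have := HAhlin m (-1) 0 0; rewrite !scaleN1r oppr0 addr0 addNr.
      by apply; exact: (HXh m).1.1.
    by rewrite addr0 [RHS]addrC addrA subrK.
  - move=> z zT; split; first by rewrite PhE //; apply: HAh0map; exact: res_mesh.
    apply: le_trans (Heps m _ (uZ z zT)) _; rewrite ler_wpM2l //.
    by rewrite le_max MZ0P ?orbT.
  have -> : CB * (eps m * MZ) * t = CB * MZ * t * eps m by ring.
  have [t0 tT'] := andP tT.
  by apply: ler_wpM2r => //; apply: ler_wpM2l => //; exact: mulr_ge0.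
(* Time constant plus space constant: using the sum for both terms adds only nonnegative cross
   terms. *)
exists (CB * D * T + CB * MZ * T) => m k k0 n nT.
have tT : 0 <= n%:R * k <= T by rewrite nT andbT mulr_ge0 // ltW.
set V := eq_scheme _ _ _ _ _ _ _.
have -> : Lh m (u (n%:R * k)) - V =
    (Lh m (u (n%:R * k)) - Uh m (n%:R * k)) + (Uh m (n%:R * k) - V).
  by rewrite addrA subrK.
have [beta beta1 B_le] := op_bounded m.
have VS : Xh0 m V.
  apply: (eq_scheme_mesh (HXh m) (HXh0 m) (HXh0sub m) (Hnh m) (HAh0lin m)
    (HAh0map m) (HLhlin m) (HLhmap m) (HLhproj m) (Lh_le m) beta1 B_le) => //.
have US := Uh_mesh m _ tT.
have [_ [_ [nD _]]] := Hnh m.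
apply: le_trans (nD _ _ _ _) _.
- apply: HXh0sub; exact: (subspaceB (HXh0 m) (HLhmap m _) US).
- apply: HXh0sub; exact: (subspaceB (HXh0 m) US VS).
apply: le_trans (lerD (space m _ tT) (glob m k n k0 nT)) _.
have k_ge0 : 0 <= k ^+ s by rewrite exprn_ge0 // ltW.
have a0 : 0 <= CB * D * T by rewrite !mulr_ge0 // ltW.
have b0 : 0 <= CB * MZ * T by rewrite !mulr_ge0 // ltW.
have := mulr_ge0 a0 (Heps_pos m); have := mulr_ge0 b0 k_ge0; lra.
Qed.
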